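(* Suppose that, as the sample size $n$ increases, the models increase their number of parameters with rates $i=O(n^{a})$ and $p=O(n)$, where $0\leq a<1$, and that $r=\lim_{n,p\to\infty}n/p>1$ (finite). Then: 1. When sampling from the simpler model $M_{i}$, $B_{pi}(\mathbf{y})\to 0$ in probability as $n\to\infty$. 2. There exists a function $\delta(r)$ such that, when sampling from the alternative model $M_{p}$, in probability as $n\to\infty$, $$B_{pi}(\mathbf{y})\to\begin{cases}\infty, & \text{if } \lim_{n\to\infty}\delta_{pi}>\delta(r),\\ 0, & \text{if } \lim_{n\to\infty}\delta_{pi}<\delta(r).\end{cases}$$ Further, this function is given by $$\delta(r)=\frac{r-1}{(r+1)^{(r-1)/r}-1}-1,$$ and it is a decreasing convex function of $r>1$ such that $\lim_{r\to\infty}\delta(r)=0$.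
   Context: For each sample size $n$ let $1\le i=i_n<p=p_n<n$ be integers, let $\mathbf{X}_{p}$ be an $n\times p$ design matrix of full column rank, and let $\mathbf{X}_{i}$ be an $n\times i$ submatrix of $\mathbf{X}_{p}$ formed by $i$ of its columns. The reduced sampling model $M_{i}$ is $\mathbf{y}\sim N(\mathbf{X}_{i}\boldsymbol{\alpha}_{i},\sigma_{i}^{2}\mathbf{I}_{n})$ and the full sampling model $M_{p}$ is $\mathbf{y}\sim N(\mathbf{X}_{p}\boldsymbol{\beta}_{p},\sigma_{p}^{2}\mathbf{I}_{n})$, where $\boldsymbol{\alpha}_i\in\mathbb{R}^i$, $\boldsymbol{\beta}_p\in\mathbb{R}^p$, $\sigma_i,\sigma_p>0$. ''Sampling from $M$'' means that for each $n$ the data $\mathbf{y}\in\mathbb{R}^n$ are drawn from $M$ with a fixed (nonrandom) sequence of parameters. Define $\mathbf{H}_{j}=\mathbf{X}_{j}(\mathbf{X}_{j}^{\prime}\mathbf{X}_{j})^{-1}\mathbf{X}_{j}^{\prime}$ for $j\in\{i,p\}$, $$\mathcal{B}_{ip}=\frac{\mathbf{y}^{\prime}(\mathbf{I}_{n}-\mathbf{H}_{p})\mathbf{y}}{\mathbf{y}^{\prime}(\mathbf{I}_{n}-\mathbf{H}_{i})\mathbf{y}},\qquad \delta_{pi}=\frac{1}{\sigma_{p}^{2}}\boldsymbol{\beta}_{p}^{\prime}\frac{\mathbf{X}_{p}^{\prime}(\mathbf{I}_{n}-\mathbf{H}_{i})\mathbf{X}_{p}}{n}\boldsymbol{\beta}_{p},$$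 where $\delta_{pi}$ (the ''distance'' from $M_p$ to $M_i$) is computed at the parameters of $M_p$ from which the data are drawn; it is assumed that $\lim_{n\to\infty}\delta_{pi}$ exists and is finite. The Bayes factor for intrinsic priors for comparing $M_{p}$ against $M_{i}$ is $$B_{pi}(\mathbf{y})=\frac{2}{\pi}(p+1)^{(p-i)/2}\int_{0}^{\pi/2}\frac{\sin^{p-i}\varphi\,(n+(p+1)\sin^{2}\varphi)^{(n-p)/2}}{(n\mathcal{B}_{ip}+(p+1)\sin^{2}\varphi)^{(n-i)/2}}\,d\varphi.$$ *)

(* Defs.v *)
From HB Require Import structures.
From mathcomp Require Import all_boot all_order all_algebra.
From mathcomp Require Import all_classical all_reals all_analysis.

Set Implicit Arguments.
Unset Strict Implicit.
Unset Printing Implicit Defensive.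

Import Order.TTheory GRing.Theory Num.Theory.
Import numFieldNormedType.Exports.

Local Open Scope classical_set_scope.
Local Open Scope ring_scope.

Section NormalVectors.
Context d (T : measurableType d) (R : realType) (P : probability T R).

Definition mutually_independent (n : nat) (Z : 'I_n -> T -> R) : Prop :=
  forall (J : {set 'I_n}) (A : 'I_n -> set R), (forall k, measurable (A k)) ->
    P (\bigcap_(k in [set` J]) (Z k @^-1` A k)) =
    (\prod_(k in J) P (Z k @^-1` A k))%E.

(* y ~ N(mu, s^2 I_n); in [normal_prob m s] the parameter s is the standard
   deviation. *)
Definition spherical_normal (n : nat) (y : T -> 'cV[R]_n) (mu : 'cV[R]_n)
    (s : R) : Prop :=
  [/\ forall k, measurable_fun [set: T] (fun t => y t k 0),
      mutually_independent (fun k t => y t k 0) &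
      forall k (A : set R), measurable A ->
        P ((fun t => y t k 0) @^-1` A) = normal_prob (mu k 0) s A].

End NormalVectors.

(* The n-th variable lives on its own probability space, so that nothing is
   assumed about the joint law across sample sizes.  Measurability is only
   required eventually, as small n carry no model. *)
Section ConvergenceInProbability.
Context (R : realType) (d : nat -> measure_display)
  (T : forall n, measurableType (d n)) (P : forall n, probability (T n) R).

Definition cvg_in_probability (Z : forall n, T n -> R) (c : R) : Prop :=
  (\forall n \near \oo, measurable_fun [set: T n] (Z n)) /\
  forall eps : R, 0 < eps ->
    P n [set t | eps < `|Z n t - c|] @[n --> \oo] --> 0%E.

Definition cvg_in_probability_pinfty (Z : forall n, T n -> R) : Prop :=
  (\forall n \near \oo, measurable_fun [set: T n] (Z n)) /\
  forall M : R, P n [set t | M < Z n t] @[n --> \oo] --> 1%E.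

End ConvergenceInProbability.

(* 1 <= i < p < n forces n >= 3, which are therefore the sample sizes; the data
   stored for n <= 2 are unconstrained and irrelevant. *)
Record nested_models (R : realType) := NestedModels {
  idim : nat -> nat;
  pdim : nat -> nat;
  full_design : forall n, 'M[R]_(n, pdim n);
  columns : forall n, 'I_(idim n) -> 'I_(pdim n);
  dims_ordered : forall n, (2 < n)%N ->
    [&& (1 <= idim n)%N, (idim n < pdim n)%N & (pdim n < n)%N];
  full_column_rank : forall n, (2 < n)%N ->
    \rank (full_design n) = pdim n;
  columns_inj : forall n, (2 < n)%N -> injective (@columns n) }.

Definition reduced_design (R : realType) (D : nested_models R) (n : nat) :
    'M[R]_(n, idim D n) :=
  colsub (@columns R D n) (full_design D n).

Definition hat_mx (R : realType) (n k : nat) (X : 'M[R]_(n, k)) : 'M[R]_n :=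
  X *m invmx (X^T *m X) *m X^T.

Definition residual_ss (R : realType) (n k : nat) (X : 'M[R]_(n, k))
    (y : 'cV[R]_n) : R :=
  (y^T *m (1%:M - hat_mx X) *m y) 0 0.

Definition B_ip (R : realType) (D : nested_models R) (n : nat)
    (y : 'cV[R]_n) : R :=
  residual_ss (full_design D n) y / residual_ss (reduced_design D n) y.

Definition delta_pi (R : realType) (D : nested_models R) (n : nat)
    (beta : 'cV[R]_(pdim D n)) (sigma : R) : R :=
  let X := full_design D n in
  (sigma ^+ 2)^-1 *
  (beta^T *m
   (n%:R^-1 *: (X^T *m (1%:M - hat_mx (reduced_design D n)) *m X)) *m
   beta) 0 0.

(* All bases of the real powers [`^] are nonnegative on the domain of
   integration. *)
Definition bayes_factor (R : realType) (D : nested_models R) (n : nat)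
    (y : 'cV[R]_n) : R :=
  let i := idim D n in
  let p := pdim D n in
  2 / pi * (p%:R + 1) `^ ((p%:R - i%:R) / 2) *
  \int[lebesgue_measure]_(phi in `[0, pi / 2])
    (sin phi ^+ (p - i) *
     (n%:R + (p%:R + 1) * sin phi ^+ 2) `^ ((n%:R - p%:R) / 2) /
     (n%:R * B_ip D y + (p%:R + 1) * sin phi ^+ 2) `^ ((n%:R - i%:R) / 2)).

Section Sampling.
Context (R : realType) (D : nested_models R) (d : nat -> measure_display)
  (T : forall n, measurableType (d n)) (P : forall n, probability (T n) R)
  (y : forall n, T n -> 'cV[R]_n).

Definition sampling_from_reduced (alpha : forall n, 'cV[R]_(idim D n))
    (sigma : nat -> R) : Prop :=
  forall n, (2 < n)%N -> 0 < sigma n /\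
    spherical_normal (P n) (@y n) (reduced_design D n *m alpha n) (sigma n).

Definition sampling_from_full (beta : forall n, 'cV[R]_(pdim D n))
    (sigma : nat -> R) : Prop :=
  forall n, (2 < n)%N -> 0 < sigma n /\
    spherical_normal (P n) (@y n) (full_design D n *m beta n) (sigma n).

End Sampling.

Definition growth_rates (R : realType) (D : nested_models R) (a r : R) :
    Prop :=
  [/\ 0 <= a < 1,
      (fun n => (idim D n)%:R : R) =O_\oo (fun n => n%:R `^ a : R),
      (fun n => (pdim D n)%:R : R) =O_\oo (fun n => n%:R : R),
      (n%:R / (pdim D n)%:R : R) @[n --> \oo] --> r &
      1 < r].

(* Main.v *)
Require Import Defs.
From mathcomp Require Import all_boot all_order all_algebra.
From mathcomp Require Import all_classical all_reals all_analysis.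
From mathcomp Require Import measurable_realfun ring lra.

(* The limit of [B_ip] in probability is [b = (1 - 1 / r) / (1 + l)], where [l] is
   the limiting distance ([l = 0] under the reduced model): both residual sums of
   squares are quadratic forms of a projection in independent normal variables,
   and their second moments show that they concentrate.  The Bayes factor depends
   on the data through [B_ip] only, and its normalised integrand is
   [exp (n / 2 * rate)] with a rate that tends, at [phi = pi / 2], to
   [(1 - 1 / r) ln (r + 1) - ln (r b + 1)], which is positive for [l > delta r] and
   negative for [l < delta r].  In the first case the neighbourhood of [pi / 2]
   alone makes the integral diverge.  In the second case [l < 1], because
   [delta r <= 1], and this is exactly what makes the rate maximal at [pi / 2], so
   that the whole integral is exponentially small.

   Convexity of [delta] comes from [1 + delta r = 1 / I r] with
   [I r = \int_0^1 (1 + v r) ^ (- 1 / r) dv], an average of functions that are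
   concave in [r]; being convex, positive and vanishing at infinity, [delta] is
   strictly decreasing. *)

Set Implicit Arguments.
Unset Strict Implicit.
Unset Printing Implicit Defensive.

Import Order.TTheory GRing.Theory Num.Theory.
Import numFieldNormedType.Exports.

Local Open Scope classical_set_scope.
Local Open Scope ring_scope.

(** * Concavity of r |-> (1 + v r) ^ (- 1 / r) *)

(** Both sampling models are instances of one situation: a mean in the column space of the full
    design, whose squared distance to the reduced column space, divided by [sigma n ^+ 2 * n], tends
    to [l]. The reduced model is the case [l = 0], below the threshold because [delta r] is
    positive.

    The two residual sums of squares are dependent, but in units of the variance each deviates from
    a multiple of [n] by the order of the square root of [n] only, so a Chebyshev bound for each and
    a union bound control their quotient. The obstacle is that independence is given for events,
    while second moments need expectations of products. The Bayes factor itself is bounded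
    deterministically, for all ratios in an interval around [b], with thresholds on [n] that depend
    on the ends of that interval only.

    With [W = (r + 1) ^ ((r - 1) / r)] the rate vanishes when [r b + 1 = W]; inserting [b] gives
    [1 + l = (r - 1) / (W - 1)], the formula for [delta]. In the limit, the condition for a maximum
    at [pi / 2] reads [1 - 1 / r <= 2 b], that is [l <= 1], and [delta r <= 1] is
    [(r + 1) / 2 <= W]. *)

Section calculus.
Context {R : realType}.
Implicit Types (f g : R -> R) (x a b : R).

Lemma is_derive_const (c : R) x : is_derive x 1 (fun=> c) 0.
Proof. exact: is_derive_cst. Qed.

Lemma is_derive_var x : is_derive x 1 (fun y : R => y) 1.
Proof. exact: is_derive_id. Qed.

Lemma is_derive_add f g x a b : is_derive x 1 f a -> is_derive x 1 g b ->
  is_derive x 1 (fun y => f y + g y) (a + b).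
Proof. exact: is_deriveD. Qed.

Lemma is_derive_sub f g x a b : is_derive x 1 f a -> is_derive x 1 g b ->
  is_derive x 1 (fun y => f y - g y) (a - b).
Proof. exact: is_deriveB. Qed.

Lemma is_derive_sqr f x a : is_derive x 1 f a ->
  is_derive x 1 (fun y => f y ^+ 2) (2 * f x * a).
Proof. by move=> df; apply: (is_derive_eq (is_deriveX 2 df)). Qed.

Lemma is_derive_mul f g x a b : is_derive x 1 f a -> is_derive x 1 g b ->
  is_derive x 1 (fun y => f y * g y) (a * g x + f x * b).
Proof.
move=> df dg; apply: (is_derive_eq (is_deriveM df dg)).
by rewrite /GRing.scale/= addrC [a * _]mulrC.
Qed.

Lemma is_derive_inv f x a : f x != 0 -> is_derive x 1 f a ->
  is_derive x 1 (fun y => (f y)^-1) (- a / f x ^+ 2).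
Proof.
move=> fx df; apply: (is_derive_eq (is_deriveV fx df)).
by rewrite /GRing.scale/= mulrC mulrN mulNr.
Qed.

Lemma is_derive_ln f x a : 0 < f x -> is_derive x 1 f a ->
  is_derive x 1 (fun y => ln (f y)) (a / f x).
Proof.
move=> fx df; rewrite mulrC.
exact: (@is_derive1_comp _ _ _ _ _ _ (is_derive1_ln fx) df).
Qed.

Lemma is_derive_expR_comp f x a : is_derive x 1 f a ->
  is_derive x 1 (fun y => expR (f y)) (a * expR (f x)).
Proof.
move=> df; rewrite mulrC.
exact: (@is_derive1_comp _ _ _ _ _ _ (is_derive_expR _) df).
Qed.

Lemma is_derive_ge0_le (f f' : R -> R) a b : a <= b ->
  (forall x, a <= x <= b -> is_derive x 1 f (f' x)) ->
  (forall x, a < x < b -> 0 <= f' x) -> f a <= f b.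
Proof.
rewrite le_eqVlt => /predU1P[-> //|ab] df f'0.
have [||c] := @MVT R f f' a b ab.
- by move=> x; rewrite in_itv/= => /andP[ax xb]; apply: df; rewrite !ltW.
- apply: derivable_within_continuous => x; rewrite in_itv/= => xab.
  by case: (df _ xab).
rewrite in_itv/= => /f'0 f'c fab.
by rewrite -subr_ge0 fab mulr_ge0// subr_ge0 ltW.
Qed.

(** Since [f'] is nondecreasing, the difference of [f] and its tangent at [c] decreases before [c]
    and increases after it; the two sides of [c] are treated separately. *)
Lemma tangent_le f f' f'' :
  (forall x, 0 < x -> is_derive x 1 f (f' x)) ->
  (forall x, 0 < x -> is_derive x 1 f' (f'' x)) ->
  (forall x, 0 < x -> 0 <= f'' x) ->
  forall c x : R, 0 < c -> 0 < x -> f c + f' c * (x - c) <= f x.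
Proof.
move=> df df' f''0.
have f'_mono x y : 0 < x -> x <= y -> f' x <= f' y.
  move=> x0 xy; apply: (@is_derive_ge0_le _ f'' _ _ xy) => z /andP[xz _].
    exact/df'/(lt_le_trans x0).
  exact/f''0/(lt_trans x0).
move=> c x c0 x0.
have dg (z : R) : 0 < z -> is_derive z 1 (fun z => f z - f' c * z) (f' z - f' c).
  move=> z0.
  apply: (is_derive_eq (is_derive_sub (df _ z0)
    (is_derive_mul (is_derive_const (f' c) z) (is_derive_var z)))).
  by rewrite mul0r mulr1 add0r.
have [cx|/ltW xc] := leP c x.
  have := @is_derive_ge0_le _ _ _ _ cx
    (fun z zcx => dg z (lt_le_trans c0 (proj1 (andP zcx)))).
  suff : (forall z, c < z < x -> 0 <= f' z - f' c) by move=> h /(_ h); lra.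
  by move=> z /andP[cz _]; rewrite subr_ge0 f'_mono// ltW.
have dgN (z : R) : 0 < z -> is_derive z 1 (fun z => f' c * z - f z) (f' c - f' z).
  move=> z0; apply: (is_derive_eq (is_derive_sub
    (is_derive_mul (is_derive_const (f' c) z) (is_derive_var z)) (df _ z0))).
  by rewrite mul0r mulr1 add0r.
have := @is_derive_ge0_le _ _ _ _ xc
  (fun z zcx => dgN z (lt_le_trans x0 (proj1 (andP zcx)))).
suff : (forall z, x < z < c -> 0 <= f' c - f' z) by move=> h /(_ h); lra.
by move=> z /andP[xz zc]; rewrite subr_ge0 f'_mono// ?ltW// (lt_trans x0).
Qed.

End calculus.

Section concavity.
Variable R : realType.
Implicit Types x v r : R.

(** The antiderivative of [x / (1 + x) ^+ 2] that vanishes at 0. It enters through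
    [k' r = - M (v * r) / r ^+ 2] below. *)
Let M x := ln (1 + x) - x / (1 + x).

Let is_derive_1D x : is_derive x 1 (fun y => 1 + y) 1.
Proof.
rewrite -[X in is_derive _ _ _ X]add0r.
exact: is_derive_add (is_derive_const 1 x) (is_derive_var x).
Qed.

Let is_derive_M x : 0 <= x -> is_derive x 1 M (x / (1 + x) ^+ 2).
Proof.
move=> x0; have x1 : 0 < 1 + x by lra.
have x1' : 1 + x != 0 by rewrite gt_eqF.
have d1 := is_derive_1D x.
apply: (is_derive_eq (is_derive_sub (is_derive_ln x1 d1)
  (is_derive_mul (is_derive_var x) (is_derive_inv x1' d1)))).
by field.
Qed.

(** The difference of the two sides vanishes at 0 and has derivative [x ^+ 2 / (1 + x) ^+ 3]. *)
Let M_ge x : 0 <= x -> x ^+ 2 / (2 * (1 + x) ^+ 2) <= M x.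
Proof.
move=> x0; rewrite -subr_ge0.
have := @is_derive_ge0_le _ (fun y => M y - y ^+ 2 / (2 * (1 + y) ^+ 2))
  (fun y => y ^+ 2 / (1 + y) ^+ 3) 0 x x0.
rewrite /M addr0 ln1 mul0r expr0n/= mul0r !subrr; apply.
- move=> y /andP[y0 _]; have y1 : 1 + y != 0 by rewrite gt_eqF//; lra.
  have y2 : 2 * (1 + y) ^+ 2 != 0 by rewrite mulf_neq0// expf_neq0.
  have d2 := is_derive_mul (is_derive_const 2 y) (is_derive_sqr (is_derive_1D y)).
  have d3 := @is_derive_inv _ (fun y => 2 * (1 + y) ^+ 2) y _ y2 d2.
  have d4 := is_derive_mul (is_derive_sqr (is_derive_var y)) d3.
  apply: (is_derive_eq (is_derive_sub (is_derive_M y0) d4)).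
  by field.
- by move=> y /andP[y0 _]; rewrite divr_ge0 ?sqr_ge0// exprn_ge0//; lra.
Qed.

(* After multiplication by powers of [r], this is [k' r ^+ 2 <= k'' r] below
   with [x = v * r]. *)
Let sqr_M_le x : 0 <= x ->
  (M x) ^+ 2 <= x * (2 * M x - (x / (1 + x)) ^+ 2).
Proof.
move=> x0; rewrite -subr_ge0.
have M0 : M 0 = 0 by rewrite /M addr0 ln1 mul0r subrr.
have := @is_derive_ge0_le _ (fun x => x * (2 * M x - (x / (1 + x)) ^+ 2) - (M x) ^+ 2)
  (fun x => (2 * M x * (1 + x + x ^+ 2) + x ^+ 2 * (x - 1) / (1 + x))
     / (1 + x) ^+ 2) 0 x x0.
rewrite M0 mul0r expr0n/= subrr; apply.
- move=> y /andP[y0 _]; have y1 : 1 + y != 0 by rewrite gt_eqF//; lra.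
  have dM := is_derive_M y0.
  have d1 := @is_derive_inv _ (fun y => 1 + y) y _ y1 (is_derive_1D y).
  have dy := is_derive_mul (is_derive_var y) d1.
  have d2 := is_derive_mul (is_derive_const 2 y) dM.
  have d3 := is_derive_mul (is_derive_var y) (is_derive_sub d2 (is_derive_sqr dy)).
  apply: (is_derive_eq (is_derive_sub d3 (is_derive_sqr dM))).
  by field.
- move=> y /andP[y0 _]; rewrite divr_ge0 ?sqr_ge0//.
  have y1 : 0 < 1 + y by lra.
  (* Replacing [M y] by its lower bound [M_ge] leaves [y ^+ 2 * ((1 + y + y ^+ 2) + (y ^+ 2 - 1)) /
     (1 + y) ^+ 2], in which the negative constant cancels. *)
  have h : y ^+ 2 * (y + 2 * y ^+ 2) / (1 + y) ^+ 2 <=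
      2 * M y * (1 + y + y ^+ 2) + y ^+ 2 * (y - 1) / (1 + y).
    rewrite -lerBlDr.
    rewrite (_ : _ - _ = 2 * (y ^+ 2 / (2 * (1 + y) ^+ 2)) * (1 + y + y ^+ 2)).
      have y3 : 0 < 1 + y + y ^+ 2 by have := sqr_ge0 y; lra.
      rewrite ler_pM2r// ler_pM2l//; apply: M_ge; exact: ltW.
    by field; rewrite gt_eqF.
  apply: le_trans h; rewrite divr_ge0 ?sqr_ge0// mulr_ge0 ?sqr_ge0//.
  by rewrite addr_ge0 ?(ltW y0)// mulr_ge0 ?sqr_ge0.
Qed.

Variable v : R.
Hypothesis v01 : 0 <= v <= 1.

(** [- k] is the logarithm of the function to be proved concave. The second derivative of
    [expR (- k r)] is [(k' r ^+ 2 - k'' r) * expR (- k r)], so concavity amounts to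
    [k' r ^+ 2 <= k'' r]. *)
Let k r := ln (1 + v * r) / r.
Let k' r := v / (r * (1 + v * r)) - ln (1 + v * r) / r ^+ 2.
Let k'' r := 2 * ln (1 + v * r) / r ^+ 3 - 2 * v / (r ^+ 2 * (1 + v * r))
  - v ^+ 2 / (r * (1 + v * r) ^+ 2).

Let pos r : 0 < r -> 0 < 1 + v * r.
Proof. by case/andP: v01 => v0 _ r0; rewrite ltr_pwDl// mulr_ge0// ltW. Qed.

Let is_derive_aff r : is_derive r 1 (fun r => 1 + v * r) v.
Proof.
have := is_derive_add (is_derive_const 1 r)
  (is_derive_mul (is_derive_const v r) (is_derive_var r)).
by rewrite mul0r mulr1 !add0r.
Qed.

Let is_derive_lnaff r : 0 < r ->
  is_derive r 1 (fun r => ln (1 + v * r)) (v / (1 + v * r)).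
Proof. by move=> /pos h; exact: (@is_derive_ln _ (fun r => 1 + v * r)). Qed.

Let is_derive_k r : 0 < r -> is_derive r 1 k (k' r).
Proof.
move=> r0; have r0' : r != 0 by rewrite gt_eqF.
have p := pos r0; have p' : 1 + v * r != 0 by rewrite gt_eqF.
have d1 := @is_derive_inv _ (fun r => r) r _ r0' (is_derive_var r).
apply: (is_derive_eq (is_derive_mul (is_derive_lnaff r0) d1)).
by rewrite /k'; field; rewrite ?r0' ?p' ?andbT //.
Qed.

Let is_derive_k' r : 0 < r -> is_derive r 1 k' (k'' r).
Proof.
move=> r0; have r0' : r != 0 by rewrite gt_eqF.
have p := pos r0; have p' : 1 + v * r != 0 by rewrite gt_eqF.
have d1 := is_derive_mul (is_derive_var r) (is_derive_aff r).
have d2 := @is_derive_inv _ (fun r => r * (1 + v * r)) r _ (mulf_neq0 r0' p') d1.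
have d3 := @is_derive_inv _ (fun r => r ^+ 2) r _ (expf_neq0 2 r0')
  (is_derive_sqr (is_derive_var r)).
apply: (is_derive_eq (is_derive_sub
  (is_derive_mul (is_derive_const v r) d2)
  (is_derive_mul (is_derive_lnaff r0) d3))).
by rewrite /k''; field; rewrite r0' p'.
Qed.

Let k'_sqr_le r : 0 < r -> k' r ^+ 2 <= k'' r.
Proof.
move=> r0; have r0' : r != 0 by rewrite gt_eqF.
have p := pos r0; have p' : 1 + v * r != 0 by rewrite gt_eqF.
have [v0 v1] := andP v01.
have vr0 : 0 <= v * r by rewrite mulr_ge0// ltW.
have := sqr_M_le vr0; set m := M (v * r) => h.
have -> : k' r ^+ 2 = m ^+ 2 / r ^+ 4.
  by rewrite /k' /m /M; field; rewrite ?r0' ?p' ?andbT //.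
have -> : k'' r = r * (2 * m - (v * r / (1 + v * r)) ^+ 2) / r ^+ 4.
  by rewrite /k'' /m /M; field; rewrite ?r0' ?p' ?andbT //.
rewrite ler_pM2r ?invr_gt0 ?exprn_gt0//.
(* Here [v <= 1] enlarges the factor [v * r] to [r]. This requires the other factor to be
   nonnegative, which for [v * r > 0] follows from [h] itself, whose left-hand side is a square. *)
apply: (le_trans h); rewrite ler_wpM2r//; last by rewrite ler_piMl// ltW.
have [vr|vr] := eqVneq (v * r) 0.
  by rewrite /m vr /M addr0 ln1 mul0r subrr mulr0 expr0n subrr.
have vr_gt0 : 0 < v * r by rewrite lt_neqAle eq_sym vr.
by rewrite -(@pmulr_rge0 _ (v * r))// (le_trans (sqr_ge0 _) h).
Qed.

Let phi r := expR (- k r).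

Let is_derive_phi r : 0 < r -> is_derive r 1 phi (- k' r * phi r).
Proof.
move=> r0; apply: (@is_derive_expR_comp _ (fun r => - k r)).
exact: is_deriveN (is_derive_k r0).
Qed.

Let phi_tangent c r : 0 < c -> 0 < r -> phi r <= phi c - k' c * phi c * (r - c).
Proof.
move=> c0 r0.
have := @tangent_le _ (fun r => - phi r) (fun r => k' r * phi r)
  (fun r => (k'' r - k' r ^+ 2) * phi r) _ _ _ c r c0 r0.
rewrite /= => h; rewrite -lerN2 opprB addrC; apply: h.
- move=> x x0; have := is_deriveN (is_derive_phi x0).
  by rewrite mulNr opprK.
- move=> x x0; apply: (is_derive_eq
   (is_derive_mul (is_derive_k' x0) (is_derive_phi x0))).
  by ring.
- by move=> x x0; rewrite mulr_ge0 ?expR_ge0// subr_ge0 k'_sqr_le.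
Qed.

Lemma concave_powRN r s p q : 0 < r -> 0 < s -> 0 <= p -> 0 <= q -> p + q = 1 ->
  p * (1 + v * r) `^ (- r^-1) + q * (1 + v * s) `^ (- s^-1) <=
  (1 + v * (p * r + q * s)) `^ (- (p * r + q * s)^-1).
Proof.
move=> r0 s0 p0 q0 pq.
have phiE x : 0 < x -> (1 + v * x) `^ (- x^-1) = phi x.
  move=> x0; rewrite /powR gt_eqF ?pos//.
  by rewrite mulNr /phi /k [in RHS]mulrC.
set c := p * r + q * s.
have c0 : 0 < c.
  have [p_gt0|] := ltP 0 p; first by rewrite ltr_pwDl ?mulr_gt0 ?mulr_ge0// ltW.
  by move=> p_le0; have -> : c = s by rewrite /c; nra.
rewrite !phiE//.
(* The tangent bounds at [c] are averaged with weights [p] and [q]; their first-order terms cancel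
   because [p * (r - c) + q * (s - c) = 0]. *)
have := lerD (ler_wpM2l p0 (phi_tangent c0 r0)) (ler_wpM2l q0 (phi_tangent c0 s0)).
move/le_trans; apply; rewrite le_eqVlt; apply/orP; left; apply/eqP.
have -> : q = 1 - p by lra.
rewrite /c (_ : q = 1 - p); first ring.
by lra.
Qed.

End concavity.

(** * The threshold function *)

Section delta.
Variable R : realType.
Implicit Types x v r : R.

Lemma FTC2_is_derive (f F : R -> R) (a b : R) : a < b ->
  (forall x, a <= x <= b -> is_derive x 1 F (f x)) ->
  (forall x, a <= x <= b -> {for x, continuous f}) ->
  \int[lebesgue_measure]_(x in `[a, b]) f x = F b - F a.
Proof.
move=> ab dF cf.
have cF x : a <= x <= b -> {for x, continuous F}.
  by move=> /dF[dFx _]; apply/differentiable_continuous/derivable1_diffP.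
rewrite /Rintegral (@continuous_FTC2 _ f F)//.
- apply/continuous_in_subspaceT => x; rewrite inE/= in_itv/=; exact: cf.
- split.
  + by move=> x; rewrite in_itv/= => /andP[ax xb]; have [] := dF x; rewrite ?ltW.
  + by apply/cvg_at_right_filter/cF; rewrite lexx ltW.
  + by apply/cvg_at_left_filter/cF; rewrite lexx ltW.
- move=> x; rewrite in_itv/= => /andP[ax xb]; have := dF x.
  by rewrite !ltW// => /(_ isT) h; rewrite derive1E derive_val.
Qed.

Let I r := \int[lebesgue_measure]_(v in `[0, 1]) (1 + v * r) `^ (- r^-1).

Let conv_gt m r s p q : m < r -> m < s -> 0 <= p -> 0 <= q -> p + q = 1 ->
  m < p * r + q * s.
Proof.
move=> mr ms p0 q0 pq; have -> : q = 1 - p by lra.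
have [->|p_neq0] := eqVneq p 0; first by lra.
have p_gt0 : 0 < p by rewrite lt_neqAle eq_sym p_neq0.
have : 0 < p * (r - m) by rewrite mulr_gt0// subr_gt0.
have : 0 <= (1 - p) * (s - m) by rewrite mulr_ge0 ?subr_ge0 ?(ltW ms)//; lra.
lra.
Qed.

Let pos v r : 0 <= v -> 0 < r -> 0 < 1 + v * r.
Proof. by move=> v0 r0; rewrite ltr_pwDl// mulr_ge0// ltW. Qed.

Let is_derive_powR v r a : 0 <= v -> 0 < r ->
  is_derive v 1 (fun v => (1 + v * r) `^ a) (r * a * (1 + v * r) `^ (a - 1)).
Proof.
move=> v0 r0.
have d1 := is_derive_add (is_derive_const 1 v)
  (is_derive_mul (is_derive_var v) (is_derive_const r v)).
rewrite mul1r mulr0 addr0 add0r in d1.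
have := @is_derive1_comp _ (fun x => x `^ a) (fun v => 1 + v * r) _ _ _
  (is_derive1_powR _ (pos v0 r0)) d1.
by rewrite mulrC mulrA.
Qed.

Let continuous_powN v r : 0 <= v -> 0 < r ->
  {for v, continuous (fun v => (1 + v * r) `^ (- r^-1))}.
Proof.
move=> v0 r0; have [h _] := is_derive_powR (- r^-1) v0 r0.
exact/differentiable_continuous/derivable1_diffP.
Qed.

Let IE r : 1 < r -> I r = ((r + 1) `^ ((r - 1) / r) - 1) / (r - 1).
Proof.
move=> r1; have r0 : 0 < r by lra.
have := @FTC2_is_derive (fun v => (1 + v * r) `^ (- r^-1))
  (fun v => (1 + v * r) `^ ((r - 1) / r) / (r - 1)) 0 1 ltr01.
rewrite mul0r mul1r addr0 powR1 -mulrBl [1 + r]addrC; apply.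
- move=> v /andP[v0 _].
  apply: (is_derive_eq (is_derive_mul (is_derive_powR ((r - 1) / r) v0 r0)
    (is_derive_const (r - 1)^-1 v))).
  have -> : (r - 1) / r - 1 = - r^-1 by field; lra.
  by field; lra.
- by move=> v /andP[v0 _]; exact: continuous_powN.
Qed.

Let I_gt0 r : 1 < r -> 0 < I r.
Proof.
move=> r1; rewrite IE// divr_gt0 ?subr_gt0//.
rewrite -[ltLHS](@powRr0 _ (r + 1)) /powR gt_eqF ?ltr_expR; last lra.
by rewrite mul0r mulr_gt0 ?divr_gt0 ?ln_gt0; lra.
Qed.

Let I_concave r s p q : 1 < r -> 1 < s -> 0 <= p -> 0 <= q -> p + q = 1 ->
  p * I r + q * I s <= I (p * r + q * s).
Proof.
move=> r1 s1 p0 q0 pq; have [r0 s0] : 0 < r /\ 0 < s by split; lra.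
have int r' : 0 < r' -> lebesgue_measure.-integrable `[0, 1]
    (EFin \o (fun v => (1 + v * r') `^ (- r'^-1))).
  move=> r'0; apply: continuous_compact_integrable; first exact: segment_compact.
  apply: continuous_in_subspaceT => x; rewrite inE/= in_itv/= => /andP[x0 _].
  exact: continuous_powN.
have c0 : 0 < p * r + q * s by exact: conv_gt.
rewrite /I -!RintegralZl//; [|exact: int..].
rewrite -RintegralD//; first last.
- exact: (integrableZl _ q (int s s0)).
- exact: (integrableZl _ p (int r r0)).
apply: le_Rintegral => //.
- exact: (integrableD _ (integrableZl _ p (int r r0)) (integrableZl _ q (int s s0))).
- exact: int.
- by move=> v; rewrite /= in_itv/= => v01; apply: concave_powRN.
Qed.

Definition delta r : R := (r - 1) / ((r + 1) `^ ((r - 1) / r) - 1) - 1.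

Let deltaE r : 1 < r -> delta r = (I r)^-1 - 1.
Proof. by move=> r1; rewrite IE// invf_div. Qed.

Let powE r a : 1 < r -> (r + 1) `^ a = expR (a * ln (r + 1)).
Proof. by move=> r1; rewrite /powR gt_eqF//; lra. Qed.

(** * Elementary bounds, convexity and limit of the threshold function *)

Lemma pow_gt1 r : 1 < r -> 1 < (r + 1) `^ ((r - 1) / r).
Proof.
move=> r1; rewrite powE// expR_gt1 mulr_gt0 ?divr_gt0 ?ln_gt0 ?subr_gt0//; lra.
Qed.

(** Positivity means [(r - 1) * ln (r + 1) < r * ln r]. This follows from
    [ln (r + 1) < ln r + 1 / r] and [1 - 1 / r <= ln r]. *)
Lemma delta_gt0 r : 1 < r -> 0 < delta r.
Proof.
move=> r1; have r0 : 0 < r by lra.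
rewrite subr_gt0 ltr_pdivlMr ?subr_gt0 ?pow_gt1// mul1r ltrD2r powE//.
rewrite -[ltRHS]lnK ?posrE// ltr_expR.
have h1 : ln (1 + r) - ln r < r^-1.
  have r10 : 0 < 1 + r by lra.
  rewrite -ln_div ?posrE//.
  have -> : (1 + r) / r = 1 + r^-1 by field; lra.
  by rewrite -ltr_expR lnK ?expR_gt1Dx ?posrE ?addr_gt0 ?invr_gt0 ?invr_neq0// gt_eqF.
have h2 : - ln r <= r^-1 - 1.
  have := @le_ln1Dx _ (r^-1 - 1); rewrite [1 + _]addrC subrK lnV ?posrE//.
  by apply; rewrite ltrBrDr addrC subrr invr_gt0.
rewrite [r + 1]addrC mulrAC ltr_pdivrMr//.
have h3 : r * r^-1 = 1 by rewrite divff// gt_eqF.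
nra.
Qed.

(** Both sides agree at [r = 1]; the tangent of the logarithm there has slope 1/2, which is at most
    [ln 2]. *)
Let ln_upper r : 1 < r -> ln (r + 1) <= r * ln 2.
Proof.
move=> r1.
have h1 : 2^-1 <= ln 2 :> R.
  have : ln 2^-1 <= - 2^-1 :> R.
    have := @le_ln1Dx R (- 2^-1).
    have -> : 1 + (- 2^-1) = 2^-1 :> R by lra.
    by apply; lra.
  by rewrite lnV ?posrE//; lra.
have : ln ((r + 1) / 2) <= (r - 1) / 2.
  have := @le_ln1Dx R ((r - 1) / 2).
  have -> : 1 + (r - 1) / 2 = (r + 1) / 2 by lra.
  by apply; lra.
rewrite ln_div ?posrE//; last lra.
nra.
Qed.

(** A rewriting of [delta r <= 1], the form in which that bound is used. *)
Lemma pow_ge r : 1 < r -> (r + 1) / 2 <= (r + 1) `^ ((r - 1) / r).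
Proof.
move=> r1; have r0 : 0 < r by lra.
have r10 : 0 < r + 1 by lra.
rewrite powE// -[leLHS]lnK ?posrE ?divr_gt0// ler_expR ln_div ?posrE//.
have -> : (r - 1) / r = 1 - r^-1 by field; lra.
suff : r^-1 * ln (r + 1) <= ln 2 by lra.
by rewrite mulrC ler_pdivrMr// mulrC ln_upper.
Qed.

(** With [w] the power in [delta], [delta r = (r - w) / (w - 1)]. One factor 2 bounds the numerator
    by [2 * ln (r + 1)], through [1 + x <= expR x] at [x = - ln (r + 1) / r]; the other is
    [(r - 1) / 2 <= w - 1] from [pow_ge]. *)
Lemma delta_le_ln r : 1 < r -> delta r <= 4 * ln (r + 1) / (r - 1).
Proof.
move=> r1; have r0 : 0 < r by lra.
have := pow_gt1 r1; have := pow_ge r1; rewrite /delta.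
set w := _ `^ _ => w2 w1.
have L0 : 0 < ln (r + 1) by apply: ln_gt0; lra.
have wl : (r + 1) * (1 - ln (r + 1) / r) <= w.
  rewrite /w powE//.
  have -> : (r - 1) / r * ln (r + 1) = ln (r + 1) + - (ln (r + 1) / r) by field; lra.
  have r10 : 0 < r + 1 by lra.
  by rewrite expRD lnK ?posrE// ler_pM2l// expR_ge1Dx.
have h : r - w <= 2 * ln (r + 1).
  have : (r + 1) * (ln (r + 1) / r) <= 2 * ln (r + 1).
    by rewrite mulrA ler_pdivrMr//; nra.
  lra.
have -> : (r - 1) / (w - 1) - 1 = (r - w) / (w - 1) by field; lra.
rewrite ler_pdivrMr ?subr_gt0// mulrAC ler_pdivlMr ?subr_gt0//.
have : 0 <= 2 * ln (r + 1) * (2 * (w - 1) - (r - 1)) by rewrite mulr_ge0; lra.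
have : (r - w) * (r - 1) <= 2 * ln (r + 1) * (r - 1) by rewrite ler_pM2r//; lra.
lra.
Qed.

(** Inversion is decreasing and convex on the positive reals, hence it turns the concavity of [I]
    into convexity of [1 / I]. *)
Lemma delta_convex r s p q : 1 < r -> 1 < s -> 0 <= p -> 0 <= q -> p + q = 1 ->
  delta (p * r + q * s) <= p * delta r + q * delta s.
Proof.
move=> r1 s1 p0 q0 pq.
have c1 : 1 < p * r + q * s by exact: conv_gt.
rewrite !deltaE//.
have := I_concave r1 s1 p0 q0 pq.
have := I_gt0 r1; have := I_gt0 s1.
set a := I r; set b := I s => b0 a0 h.
have ab0 : 0 < p * a + q * b by exact: conv_gt.
suff : (p * a + q * b)^-1 <= p * a^-1 + q * b^-1.
  have : (I (p * r + q * s))^-1 <= (p * a + q * b)^-1.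
    by rewrite lef_pV2 ?posrE ?(lt_le_trans ab0 h).
  by lra.
rewrite -(@ler_pM2l _ (p * a + q * b))// divff ?gt_eqF//.
have -> : (p * a + q * b) * (p / a + q / b) =
    (p + q) ^+ 2 + p * q * ((a - b) ^+ 2 / (a * b)).
  by field; rewrite !gt_eqF.
by rewrite pq expr1n lerDl mulr_ge0 ?(mulr_ge0 p0)// divr_ge0 ?sqr_ge0 ?mulr_ge0 ?ltW.
Qed.

Lemma delta_cvgy : delta r @[r --> +oo] --> 0.
Proof.
apply/cvgrPdist_le => e e0.
have e16 : 0 < e / 16 by lra.
(* The sublinearity of [ln] at [(r + 1) * (e / 16)] gives [4 * ln (r + 1) <= (r + 1) * e / 4 + 4 *
   C], and the threshold on [r] gives [4 * C < (r - 2) * e / 2]; together they stay below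
   [3 / 4 * (r - 1) * e]. *)
set C := - ln (e / 16).
near=> r.
have r1 : 1 < r by near: r; apply: nbhs_pinfty_gt; exact: num_real.
have rC : 2 + 8 / e * C < r by near: r; apply: nbhs_pinfty_gt; exact: num_real.
rewrite sub0r normrN gtr0_norm ?delta_gt0//.
rewrite (le_trans (delta_le_ln r1))// ler_pdivrMr ?subr_gt0//.
have ? : 0 < r + 1 by lra.
have : ln ((r + 1) * (e / 16)) <= (r + 1) * (e / 16).
  by apply/ltW/ln_sublinear; rewrite mulr_gt0.
rewrite lnM ?posrE//.
have : 8 * C < (r - 2) * e by rewrite -ltr_pdivrMr//; lra.
rewrite -[ln (e / 16)]opprK -/C.
have : 1 * e < r * e by rewrite ltr_pM2r.
lra.
Unshelve. all: by end_near. Qed.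

Lemma delta_decreasing r s : 1 < r -> r < s -> delta s < delta r.
Proof.
move=> r1 rs; rewrite ltNge; apply/negP => h.
have s1 := lt_trans r1 rs.
have d0 := delta_gt0 s1.
(* The point [s] is a convex combination of [r] and [t]. As [delta r <= delta s], convexity forbids
   [delta t < delta s], so [delta] would stay above the positive value [delta s] for ever. *)
have H t : s < t -> delta s <= delta t.
  move=> st; pose p := (t - s) / (t - r); pose q := (s - r) / (t - r).
  have tr : t - r != 0 by rewrite gt_eqF//; lra.
  have p0 : 0 < p by rewrite divr_gt0; lra.
  have q0 : 0 < q by rewrite divr_gt0; lra.
  have pq : p + q = 1 by rewrite /p /q; field.
  have := delta_convex r1 (lt_trans s1 st) (ltW p0) (ltW q0) pq.
  have -> : p * r + q * t = s by rewrite /p /q; field.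
  by nra.
have : \forall t \near +oo, delta t < delta s.
  by have /cvgr_lt := delta_cvgy; exact.
move=> [M [_ HM]].
have Mt : M < Num.max M s + 1 by rewrite ltr_pwDr// le_max lexx.
have st : s < Num.max M s + 1 by rewrite ltr_pwDr// le_max lexx orbT.
by have := HM _ Mt; rewrite ltNge (H _ st).
Qed.

End delta.

(** * Expectation of products of independent variables *)

Section density.
Context d d' (T : measurableType d) (T' : measurableType d') (R : realType).
Variables (mu : {measure set T -> \bar R}) (P : probability T' R).
Local Open Scope ereal_scope.

Import HBNNSimple.

(* The measure with density [G] with respect to [mu] is carried by [X] to
   [c] times the law of [Y]. *)
Lemma ge0_integral_density (X : T -> R) (Y : T' -> R) (G : T -> R)
    (h : R -> R) (c : \bar R) : c \is a fin_num ->
  measurable_fun [set: T] X -> measurable_fun [set: T'] Y ->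
  mu.-integrable [set: T] (EFin \o G) -> (forall t, 0 <= G t)%R ->
  (forall A, measurable A ->
    \int[mu]_t (G t * \1_A (X t))%:E = c * P (Y @^-1` A)) ->
  measurable_fun [set: R] h -> (forall x, 0 <= h x)%R ->
  \int[mu]_t (G t * h (X t))%:E = c * \int[P]_t (h (Y t))%:E.
Proof.
move=> cfin mX mY iG G0 GX mh h0.
have mG : measurable_fun [set: T] G by apply/measurable_EFinP; exact: measurable_int iG.
have mhE : measurable_fun [set: R] (EFin \o h) by exact/measurable_EFinP.
pose h_ := nnsfun_approx measurableT mhE.
have mY1 A : measurable A -> measurable (Y @^-1` A).
  by move=> mA; rewrite -[X in measurable X]setTI; exact: mY.
have m1X A : measurable A -> measurable_fun [set: T] (\1_A \o X : T -> R)%R.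
  by move=> mA; apply: measurableT_comp.
have i1Y A : measurable A -> P.-integrable [set: T'] (EFin \o (\1_A \o Y))%R.
  move=> mA; rewrite (_ : \1_A \o Y = \1_(Y @^-1` A))%R; last first.
    by apply/funext => t; rewrite /= !indicE.
  by apply: integrable_indic; exact: mY1.
have e1Y A : measurable A -> \int[P]_t (\1_A (Y t))%:E = P (Y @^-1` A).
  by move=> mA; rewrite -[in RHS](setIT (Y @^-1` A)) -integral_indic//; exact: mY1.
have iGX A : measurable A -> mu.-integrable [set: T] (fun t => (G t * \1_A (X t))%:E).
  move=> mA; apply: le_integrable iG => //.
    by apply/measurable_EFinP; apply: measurable_funM => //; exact: m1X.
  move=> t _ /=; rewrite lee_fin normrM ler_piMr// indicE.
  by case: (_ \in _); rewrite ?normr1 ?normr0.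
(* A simple function is a finite combination of indicators of its level sets, to each of which the
   hypothesis [GX] applies. *)
have hE n : \int[mu]_t (G t * h_ n (X t))%:E = c * \int[P]_t (h_ n (Y t))%:E.
  have mhn r : measurable (h_ n @^-1` [set r]) by exact: measurable_sfunP.
  under eq_integral do rewrite fimfunEord mulr_sumr -sumEFin.
  under [X in _ = _ * X]eq_integral do rewrite fimfunEord -sumEFin.
  rewrite integral_sum//; last first.
    move=> i; apply: eq_integrable (integrableZl measurableT _ (iGX _ (mhn _))) => //.
    by move=> t _; rewrite -EFinM mulrCA.
  rewrite integral_sum//; last first.
    move=> i; exact: (integrableZl measurableT _ (i1Y _ (mhn _))).
  rewrite fin_num_sume_distrr//; last first.
    move=> i j _ _; apply: fin_num_adde_defl; apply: integrable_fin_num => //.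
    exact: (integrableZl measurableT _ (i1Y _ (mhn _))).
  apply: eq_bigr => i _.
  under eq_integral do rewrite mulrCA EFinM.
  under [in RHS]eq_integral do rewrite EFinM.
  rewrite !integralZl ?GX//; [|exact: i1Y|exact: iGX].
  by rewrite muleCA e1Y.
have cvg_h x : (h_ n x)%:E @[n --> \oo] --> (h x)%:E.
  by apply: (cvg_nnsfun_approx measurableT mhE (fun y _ => _)) => // y; rewrite lee_fin.
(* Monotone convergence, stated for any measure and density so that it serves both sides: density
   [G] on the left, density 1 on the right. *)
have lim_eq d0 (T0 : measurableType d0) (nu : {measure set T0 -> \bar R})
    (F V : T0 -> R) :
    measurable_fun [set: T0] F -> (forall t, 0 <= F t)%R ->
    measurable_fun [set: T0] V ->
    (fun n => \int[nu]_t (F t * h_ n (V t))%:E) @ \oo --> \int[nu]_t (F t * h (V t))%:E.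
  move=> mF F0 mV.
  have -> : \int[nu]_t (F t * h (V t))%:E =
      \int[nu]_t limn (fun n => (F t * h_ n (V t))%:E).
    apply: eq_integral => t _; apply/esym/cvg_lim => //.
    by under eq_fun do rewrite EFinM; rewrite EFinM; apply: cvgeZl => //; exact: cvg_h.
  apply: cvg_monotone_convergence => //.
  - move=> n; apply/measurable_EFinP; apply: measurable_funM => //.
    exact: measurableT_comp.
  - by move=> n t _; rewrite lee_fin mulr_ge0.
  - move=> t _ m n mn; rewrite lee_fin ler_wpM2l//.
    exact/lefP/nd_nnsfun_approx.
have L1 := lim_eq _ _ mu _ _ mG G0 mX.
rewrite (_ : (fun n => _) = (fun n => c * \int[P]_t (h_ n (Y t))%:E))
  in L1; last exact/funext.
apply: (cvg_unique _ L1) => //.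
apply: cvgeZl => //.
have e1 (k : R -> R) : \int[P]_t (cst 1 t * k (Y t))%:E = \int[P]_t (k (Y t))%:E.
  by apply: eq_integral => t _; rewrite mul1r.
have := lim_eq _ _ P (cst 1%R) _ (measurable_cst _) (fun=> ler01) mY; rewrite e1.
by rewrite (_ : (fun n => _) = (fun n => \int[P]_t (h_ n (Y t))%:E)); last exact/funext.
Qed.

End density.

Section product_expectation.
Context d (T : measurableType d) (R : realType) (P : probability T R).
Local Open Scope ereal_scope.
Variables (n : nat) (Z : 'I_n -> T -> R).
Hypothesis mZ : forall k, measurable_fun [set: T] (Z k).
Hypothesis indepZ : mutually_independent P Z.

Let upd (f : 'I_n -> R -> R) i g k : R -> R := if k == i then g else f k.

Let prod_upd f i g t : (\prod_k upd f i g k (Z k t) =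
  g (Z i t) * \prod_(k | k != i) f k (Z k t))%R.
Proof.
rewrite (bigD1 i)//= /upd eqxx; congr (_ * _)%R.
by apply: eq_bigr => k /negPf ->.
Qed.

Let eprod_upd f i g : \prod_k \int[P]_t (upd f i g k (Z k t))%:E =
  \int[P]_t (g (Z i t))%:E * \prod_(k | k != i) \int[P]_t (f k (Z k t))%:E.
Proof.
rewrite (bigD1 i)//= /upd eqxx; congr (_ * _).
by apply: eq_bigr => k /negPf ->.
Qed.

Let factors (f : 'I_n -> R -> R) :=
  P.-integrable [set: T] (fun t => (\prod_k f k (Z k t))%:E) /\
  \int[P]_t (\prod_k f k (Z k t))%:E = \prod_k \int[P]_t (f k (Z k t))%:E.

Let mpreZ k A : measurable A -> measurable (Z k @^-1` A).
Proof. by move=> mA; rewrite -[X in measurable X]setTI; exact: mZ. Qed.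

Let expect_indic k A : measurable A ->
  \int[P]_t (\1_A (Z k t))%:E = P (Z k @^-1` A).
Proof.
by move=> mA; rewrite -[in RHS](setIT (Z k @^-1` A)) -integral_indic//; exact: mpreZ.
Qed.

Let factors_indic (A : 'I_n -> set R) : (forall k, measurable (A k)) ->
  factors (fun k => \1_(A k)).
Proof.
move=> mA; pose B := \bigcap_(k in [set` [set: 'I_n]%SET]) (Z k @^-1` A k).
have mB : measurable B by apply: fin_bigcap_measurable => // k _; exact: mpreZ.
have BE t : (\prod_k \1_(A k) (Z k t) = \1_B t :> R)%R.
  rewrite indicE; case: (pselect (B t)) => [Bt|].
    rewrite mem_set// big1// => k _; rewrite indicE mem_set//.
    by apply: Bt; rewrite /= inE.
  move=> /[dup] nB /existsNP[k /not_implyP[_ nA]].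
  by rewrite [in RHS]memNset// (bigD1 k)//= indicE memNset// mul0r.
split; first by under eq_fun do rewrite BE; exact: integrable_indic.
under eq_integral do rewrite BE.
rewrite integral_indic// setIT /B; apply: etrans (indepZ [set: _]%SET mA) _.
by apply: eq_big => [k|k _]; rewrite ?inE// expect_indic.
Qed.

(** Induction on the number [m] of coordinates allowed to carry general functions. For the
    coordinate [i] of index [m], the induction hypothesis with arbitrary indicators in place [i]
    says that the product of the other factors is a density carried by [Z i] to a multiple of its
    law; [ge0_integral_density] then replaces the indicator by [f i]. *)
Let factors_nneg m (f : 'I_n -> R -> R) (A : 'I_n -> set R) :
  (forall k, measurable_fun [set: R] (f k)) ->
  (forall k x, 0 <= f k x)%R ->
  (forall k, P.-integrable [set: T] (fun t => (f k (Z k t))%:E)) ->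
  (forall k, measurable (A k)) ->
  (forall k : 'I_n, (m <= k)%N -> f k = \1_(A k)) -> factors f.
Proof.
elim: m f A => [|m IH] f A mf f0 intf mA fA.
  by rewrite (_ : f = (fun k => \1_(A k))); [exact: factors_indic|apply/funext => k; exact: fA].
have [nm|mn] := leqP n m.
  by apply: (IH f A) => // k mk; have := leq_trans nm mk; rewrite leqNgt ltn_ord.
pose i := Ordinal mn.
pose G t := (\prod_(k | k != i) f k (Z k t))%R.
have upd_ok C : measurable C -> factors (upd f i \1_C).
  move=> mC; apply: (IH _ (fun k => if k == i then C else A k)).
  - by move=> k; rewrite /upd; case: ifP => // _; exact: measurable_indic.
  - by move=> k x; rewrite /upd; case: ifP => // _; rewrite indicE.
  - move=> k; rewrite /upd; case: ifPn => // /eqP ->.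
    rewrite (_ : (fun t => _) = EFin \o \1_(Z i @^-1` C)); last first.
      by apply/funext => t /=; rewrite !indicE.
    by apply: integrable_indic => //; exact: mpreZ.
  - by move=> k; case: ifP.
  - move=> k mk; rewrite /upd; case: ifPn => // ki; apply: fA.
    by rewrite ltn_neqAle mk andbT eq_sym; apply: contra ki => /eqP ?; apply/eqP/val_inj.
(* The indicator of the whole line in place [i] yields the integrability and the integral of the
   product [G] of the other factors. *)
have GE t : (\prod_k upd f i \1_setT k (Z k t) = G t)%R.
  by rewrite prod_upd indicT mul1r.
have [iG eG] := upd_ok _ measurableT.
rewrite (_ : (fun t => _) = EFin \o G) in iG; last first.
  by apply/funext => t; rewrite GE.
rewrite (eq_integral (EFin \o G)) in eG; last by move=> t _; rewrite GE.
rewrite eprod_upd expect_indic// preimage_setT probability_setT mul1e in eG.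
have G0 t : (0 <= G t)%R by apply: prodr_ge0.
have fE t : (\prod_k f k (Z k t) = G t * f i (Z i t))%R.
  by rewrite (bigD1 i)//= mulrC.
have intE : \int[P]_t (\prod_k f k (Z k t))%:E = \prod_k \int[P]_t (f k (Z k t))%:E.
  under eq_integral do rewrite fE.
  rewrite (@ge0_integral_density _ _ _ _ _ P P (Z i) (Z i) G (f i) (\int[P]_t (G t)%:E))//.
  - by rewrite [RHS](bigD1 i)//= muleC eG.
  - exact: integrable_fin_num.
  move=> C mC; have [_ eC] := upd_ok _ mC.
  rewrite (eq_integral (fun t => (G t * \1_C (Z i t))%:E)) in eC; last first.
    by move=> t _; rewrite prod_upd mulrC.
  by rewrite eC eprod_upd expect_indic// -eG muleC.
split=> //; apply/integrableP; split.
  apply/measurable_EFinP; apply: measurable_prod => k _.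
  exact: measurableT_comp.
under eq_integral => t _ do rewrite /= ger0_norm ?prodr_ge0//.
rewrite intE ltey_eq; apply/orP; left.
by apply: prode_fin_num => k _; exact: integrable_fin_num.
Qed.

Lemma integral_prod_independent (f : 'I_n -> R -> R) :
  (forall k, measurable_fun [set: R] (f k)) ->
  (forall k, P.-integrable [set: T] (fun t => (f k (Z k t))%:E)) ->
  P.-integrable [set: T] (fun t => (\prod_k f k (Z k t))%:E) /\
  \int[P]_t (\prod_k f k (Z k t))%:E = \prod_k \int[P]_t (f k (Z k t))%:E.
Proof.
move=> mf intf; suff : factors f by [].
(* A second induction, on the number of coordinates whose function may change sign: such a function
   is split into its positive and negative parts, and the induction hypothesis applies to both. *)
suff H m : (forall k : 'I_n, (m <= k)%N -> forall x, (0 <= f k x)%R) -> factors f.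
  by apply: (H n) => k; rewrite leqNgt ltn_ord.
elim: m f mf intf => [|m IH] f mf intf f0.
  apply: (@factors_nneg n f (fun=> set0)) => //.
    by move=> k; exact: f0.
  by move=> k; rewrite leqNgt ltn_ord.
have [nm|mn] := leqP n m.
  by apply: (IH f) => // k mk; have := leq_trans nm mk; rewrite leqNgt ltn_ord.
pose i := Ordinal mn.
have upd_ok (g : R -> R) : measurable_fun [set: R] g -> (forall x, 0 <= g x)%R ->
    P.-integrable [set: T] (fun t => (g (Z i t))%:E) -> factors (upd f i g).
  move=> mg g0 ig; apply: IH.
  - by move=> k; rewrite /upd; case: ifP.
  - by move=> k; rewrite /upd; case: ifPn => // /eqP ->.
  - move=> k mk; rewrite /upd; case: ifPn => // ki; apply: f0.
    by rewrite ltn_neqAle mk andbT eq_sym; apply: contra ki => /eqP ?; apply/eqP/val_inj.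
have ip : P.-integrable [set: T] (fun t => ((f i)^\+%R (Z i t))%:E).
  exact: (integrable_funrpos measurableT (intf i)).
have im : P.-integrable [set: T] (fun t => ((f i)^\-%R (Z i t))%:E).
  exact: (integrable_funrneg measurableT (intf i)).
have [ip' ep] := upd_ok _ (measurable_funrpos (mf i)) (fun x => funrpos_ge0 _ x) ip.
have [im' em] := upd_ok _ (measurable_funrneg (mf i)) (fun x => funrneg_ge0 _ x) im.
have fE t : ((\prod_k f k (Z k t))%:E =
   (\prod_k upd f i (f i)^\+%R k (Z k t))%:E - (\prod_k upd f i (f i)^\-%R k (Z k t))%:E).
  rewrite -EFinB !prod_upd -mulrBl (bigD1 i)//=; congr (_ * _)%:E.
  by rewrite -[in LHS](funrposBneg (f i)).
split; first by under eq_fun do rewrite fE; exact: integrableB.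
under eq_integral do rewrite fE.
rewrite integralB// ep em !eprod_upd -muleBl; last 2 first.
- by apply: prode_fin_num => k _; exact: integrable_fin_num.
- by apply: fin_num_adde_defr; exact: integrable_fin_num.
rewrite [RHS](bigD1 i)//=; congr (_ * _).
rewrite -integralB//.
by apply: eq_integral => t _; rewrite -EFinB -[in RHS](funrposBneg (f i)).
Qed.

End product_expectation.

(** * Moments of the normal distribution *)

(* The first two moments of a standard normal variable [u] are obtained by
   integrating [1 + x <= expR x] for [x] a multiple of [u] or of [u ^+ 2]: the
   integral of the right-hand side reduces to the normalisation of another
   normal density. *)
Lemma tangent_expR_sqr_eq0 (R : realType) (v : R) :
  (forall a, 1 + a * v <= expR (a ^+ 2 / 2)) -> v = 0.
Proof.
move=> tangent.
have exp_le (x : R) : (0 <= x <= 2^-1 -> expR x <= 1 + 2 * x).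
  move=> /andP[x0 x2]; have := expR_ge1Dx (- x); have := expR_gt0 x.
  have := expRxMexpNx_1 x; set e := expR x; set e' := expR (- x).
  by move=> ee e0 e'0; nra.
apply/eqP/negPn/negP => v_neq0.
(* For [a = c * v] this makes [expR (a ^+ 2 / 2)] at most [1 + c ^+ 2 * v ^+ 2], while the left-hand
   side is [1 + c * v ^+ 2], strictly larger because [c <= 1 / 2]. *)
pose c := ((2 * (1 + `|v|))^-1).
have c0 : (0 < c) by rewrite invr_gt0 mulr_gt0// ltr_pwDl.
have cv : (`|c * v| <= 2^-1).
  rewrite normrM gtr0_norm// /c invfM -mulrA ler_piMr// ler_pdivrMl ?ltr_pwDl//.
  by rewrite mulr1 lerDr.
have cv2 : ((c * v) ^+ 2 <= 2^-1).
  rewrite -real_normK ?num_real// expr2; have := normr_ge0 (c * v); nra.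
have c2 : (c <= 2^-1).
  rewrite /c lef_pV2 ?posrE ?mulr_gt0 ?ltr_pwDl//.
  by have := normr_ge0 v; lra.
have v2 : (0 < v ^+ 2) by rewrite exprn_even_gt0.
have := tangent (c * v); apply/negP; rewrite -ltNge.
rewrite (@le_lt_trans _ _ (1 + 2 * ((c * v) ^+ 2 / 2)))//.
  by apply: exp_le; rewrite divr_ge0 ?sqr_ge0//=; lra.
rewrite ltrD2l exprMn; nra.
Qed.

(** At [k = 1] both sides agree, so their derivatives [v] and 1 must agree too. Concretely,
    [k = 1 + e] with [e] a small multiple of [v - 1] contradicts the inequality unless [v = 1]. *)
Lemma tangent_self_eq1 (R : realType) (v : R) : 0 <= v ->
  (forall k, 0 < k -> 1 + (1 - k ^- 2) / 2 * v <= k) -> v = 1.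
Proof.
move=> v0 tangent.
have tangent' e : (-1 < e -> e * (2 * (v - 1) + e * (v - 4 - 2 * e)) <= 0).
  move=> e1; have k0 : (0 < 1 + e) by lra.
  have h := tangent _ k0; rewrite -subr_ge0 in h.
  have k2 : (0 < 2 * (1 + e) ^+ 2) by rewrite mulr_gt0// exprn_gt0.
  rewrite -oppr_ge0 (_ : - _ = (2 * (1 + e) ^+ 2) * (1 + e - (1 + (1 - (1 + e) ^- 2) / 2 * v))).
    by rewrite mulr_ge0// ltW.
  by field; rewrite gt_eqF.
apply/eqP; rewrite -subr_eq0; set w := (v - 1) in tangent' *.
apply/negPn/negP => w0.
pose c := ((4 * (1 + `|w|))^-1).
have c0 : (0 < c) by rewrite invr_gt0 mulr_gt0// ltr_pwDl.
have cw : (`|c * w| <= 4^-1).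
  rewrite normrM gtr0_norm// /c invfM -mulrA ler_piMr// ler_pdivrMl ?ltr_pwDl//.
  by rewrite mulr1 lerDr.
have c4 : (c <= 4^-1).
  rewrite /c lef_pV2 ?posrE ?mulr_gt0 ?ltr_pwDl//.
  by have := normr_ge0 w; lra.
have := cw; rewrite ler_norml => /andP[cw1 cw2].
have w2 : (0 < w ^+ 2) by rewrite exprn_even_gt0.
have ecw : (-1 < c * w) by lra.
have := tangent' _ ecw.
have -> : c * w * (2 * w + c * w * (v - 4 - 2 * (c * w))) =
    c * w ^+ 2 * (2 + c * (v - 4 - 2 * (c * w))) by ring.
apply/negP; rewrite -ltNge; apply: mulr_gt0; first exact: mulr_gt0.
have : 0 <= c * v by rewrite mulr_ge0// ltW.
have : c * (c * w) <= c * 4^-1 by rewrite ler_pM2l.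
rewrite (_ : 2 + _ = 2 + c * v - 4 * c - 2 * (c * (c * w))); last by ring.
lra.
Qed.

Section normal_moments.
Context d (T : measurableType d) (R : realType) (P : probability T R).
Variables (y : T -> R) (m s : R).
Hypothesis my : measurable_fun [set: T] y.
Hypothesis s_gt0 : 0 < s.
Hypothesis law_y : forall A, measurable A -> P (y @^-1` A) = normal_prob m s A.

Let u t := (y t - m) / s.

Let s_neq0 : s != 0. Proof. by rewrite gt_eqF. Qed.

Let mu : measurable_fun [set: T] u.
Proof. by apply: measurable_funM => //; apply: measurable_funB. Qed.

Local Open Scope ereal_scope.

Let expect_density (h : R -> R) : measurable_fun [set: R] h ->
  (forall x, 0 <= h x)%R ->
  \int[P]_t (h (y t))%:E = \int[lebesgue_measure]_x (normal_pdf m s x * h x)%:E.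
Proof.
move=> mh h0; rewrite -[LHS]mul1e; apply/esym.
apply: ge0_integral_density => //; first exact: integrable_normal_pdf.
  by move=> x; exact: normal_pdf_ge0.
move=> A mA; rewrite mul1e law_y// /normal_prob.
rewrite [RHS]integral_mkcond; apply: eq_integral => x _.
by rewrite /patch /= indicE; case: ifPn => xA; rewrite ?mulr1 ?mulr0.
Qed.

Let pdfE (a b x : R) : (b != 0)%R -> (normal_pdf a b x =
  normal_peak b * expR (- (x - a) ^+ 2 / (b ^+ 2 *+ 2)))%R.
Proof. by move=> b0; rewrite normal_pdfE. Qed.

Let mgf (a : R) : \int[P]_t (expR (a * u t))%:E = (expR (a ^+ 2 / 2))%:E.
Proof.
rewrite (@expect_density (fun x => expR (a * ((x - m) / s))))//; last first.
  apply: measurableT_comp; first exact: measurable_expR.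
  by apply: measurable_funM => //; apply: measurable_funM => //; exact: measurable_funB.
under eq_integral => x _.
  (* Completing the square: the exponential weight shifts the mean by [a * s]. *)
  have -> : (normal_pdf m s x * expR (a * ((x - m) / s)) =
     expR (a ^+ 2 / 2) * normal_pdf (m + a * s) s x)%R.
    rewrite !pdfE// -[LHS]mulrA -expRD [RHS]mulrCA -expRD.
    by congr (_ * expR _)%R; field.
  rewrite EFinM; over.
rewrite integralZl//; last exact: integrable_normal_pdf.
by rewrite integral_normal_pdf// mule1.
Qed.

(** The exponent is parametrised by the factor [k] by which the weight stretches the standard
    deviation: the weighted density is [k] times the normal density with deviation [k * s]. *)
Let mgf_sqr (k : R) : (0 < k)%R ->
  \int[P]_t (expR ((1 - k ^- 2) / 2 * u t ^+ 2))%:E = k%:E.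
Proof.
move=> k0; have k_neq0 : k != 0%R by rewrite gt_eqF.
have ks_neq0 : (k * s != 0)%R by rewrite mulf_neq0.
rewrite (@expect_density (fun x => expR ((1 - k ^- 2) / 2 * ((x - m) / s) ^+ 2)))//; last first.
  apply: measurableT_comp; first exact: measurable_expR.
  apply: measurable_funM => //; apply: measurable_funX.
  by apply: measurable_funM => //; exact: measurable_funB.
under eq_integral => x _.
  have -> : (normal_pdf m s x * expR ((1 - k ^- 2) / 2 * ((x - m) / s) ^+ 2) =
     k * normal_pdf m (k * s) x)%R.
    rewrite !pdfE// -[LHS]mulrA -expRD [RHS]mulrA.
    congr (_ * expR _)%R; last by field; rewrite s_neq0 k_neq0.
    rewrite /normal_peak exprMn.
    rewrite -[X in (k * (Num.sqrt X)^-1)%R]mulrnAr -[X in (k * (Num.sqrt X)^-1)%R]mulrA.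
    rewrite mulrnAr sqrtrM ?sqr_ge0// sqrtr_sqr gtr0_norm//.
    by rewrite invfM mulrA divff// mul1r.
  rewrite EFinM; over.
rewrite integralZl//; last exact: integrable_normal_pdf.
by rewrite integral_normal_pdf// mule1.
Qed.

Let measurable_expu a : measurable_fun [set: T] (fun t => expR (a * u t)).
Proof.
apply: measurableT_comp; first exact: measurable_expR.
exact: measurable_funM.
Qed.

Let measurable_expu2 a : measurable_fun [set: T] (fun t => expR (a * u t ^+ 2)).
Proof.
apply: measurableT_comp; first exact: measurable_expR.
by apply: measurable_funM => //; exact: measurable_funX.
Qed.

Let integrable_expu2 k : (0 < k)%R ->
  P.-integrable [set: T] (fun t => (expR ((1 - k ^- 2) / 2 * u t ^+ 2))%:E).
Proof.
move=> k0; apply/integrableP; split; first exact/measurable_EFinP/measurable_expu2.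
under eq_integral => t _ do rewrite /= ger0_norm ?expR_ge0//.
by rewrite mgf_sqr// ltry.
Qed.

Let pow4_ge0 t : (0 <= u t ^+ 4)%R.
Proof. by rewrite -[4%N]/(2 * 2)%N exprM sqr_ge0. Qed.

Let pow4_le t : (u t ^+ 4 <= 128 * expR ((1 - 2 ^- 2) / 2 * u t ^+ 2))%R.
Proof.
set z := ((1 - 2 ^- 2) / 2 * u t ^+ 2)%R.
have z0 : (0 <= z)%R by rewrite mulr_ge0 ?sqr_ge0//; lra.
have := expR_ge1Dxn 1 z0; rewrite /z exprMn -exprM.
set e := expR _ => h; rewrite (le_trans _ (ler_wpM2l _ h))//.
by rewrite !factS fact0; have := pow4_ge0 t; lra.
Qed.

Lemma integrable_normal4 : P.-integrable [set: T] (fun t => (u t ^+ 4)%:E).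
Proof.
have i2 := integrable_expu2 (ltr0Sn R 1).
apply: le_integrable (integrableZl measurableT 128 i2) => //.
  by apply/measurable_EFinP; exact: measurable_funX.
move=> t _; rewrite -EFinM /= lee_fin.
rewrite (ger0_norm (pow4_ge0 t)) ger0_norm ?pow4_le// ?mulr_ge0 ?expR_ge0.
Qed.

(** A crude bound on the fourth moment, which is 3: 128 comes from [pow4_le], and the factor 2 is
    the value of [mgf_sqr] at [k = 2]. *)
Lemma expect_normal4_le : \int[P]_t (u t ^+ 4)%:E <= 256%:E.
Proof.
have -> : 256%:E = 128%:E * 2%:E :> \bar R by rewrite -EFinM; congr EFin; lra.
rewrite -(@mgf_sqr 2)// -integralZl//; last exact: integrable_expu2.
apply: le_integral => //; first exact: integrable_normal4.
  by apply: integrableZl => //; exact: integrable_expu2.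
by move=> t _; rewrite -EFinM lee_fin pow4_le.
Qed.

Lemma integrable_normal_pow k : (k <= 4)%N ->
  P.-integrable [set: T] (fun t => (u t ^+ k)%:E).
Proof.
move=> k4.
have i1 : P.-integrable [set: T] (cst 1 : T -> \bar R).
  exact: finite_measure_integrable_cst.
apply: le_integrable (integrableD measurableT i1 integrable_normal4) => //.
  by apply/measurable_EFinP; exact: measurable_funX.
move=> t _; rewrite /= lee_fin.
have u4 := pow4_ge0 t.
rewrite [leRHS]ger0_norm ?addr_ge0// normrX.
rewrite -(@ger0_norm _ (u t ^+ 4))// normrX.
have [u1|/ltW u1] := leP `|u t|%R 1%R.
  by rewrite (@le_trans _ _ 1)%R ?exprn_ile1// lerDl exprn_ge0.
by rewrite (@le_trans _ _ (`|u t| ^+ 4))%R ?ler_weXn2l// lerDr.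
Qed.

Lemma expect_normal1 : \int[P]_t (u t)%:E = 0.
Proof.
have iu : P.-integrable [set: T] (fun t => (u t)%:E).
  exact: (@integrable_normal_pow 1).
have := integrable_fin_num measurableT iu.
case eu : (\int[P]_t (u t)%:E) => [v| |]// _; congr (_%:E).
have i1 : P.-integrable [set: T] (cst 1 : T -> \bar R).
  exact: finite_measure_integrable_cst.
have tangent a : (1 + a * v <= expR (a ^+ 2 / 2))%R.
  rewrite -lee_fin -mgf EFinD EFinM -eu -integralZl//.
  have -> : 1%:E = \int[P]_t (cst 1 t).
    by rewrite integral_cst// -[X in _ * X]/(P setT) probability_setT mule1.
  rewrite -integralD//; last exact: integrableZl.
  apply: le_integral => //.
  - by apply: integrableD => //; exact: integrableZl.
  - apply/integrableP; split; first exact/measurable_EFinP/measurable_expu.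
    under eq_integral => t _ do rewrite /= ger0_norm ?expR_ge0//.
    by rewrite mgf ltry.
  - by move=> t _; rewrite /= -EFinM -EFinD lee_fin expR_ge1Dx.
exact: tangent_expR_sqr_eq0.
Qed.

Lemma expect_normal2 : \int[P]_t (u t ^+ 2)%:E = 1.
Proof.
have iu := @integrable_normal_pow 2 isT.
have := integrable_fin_num measurableT iu.
case eu : (\int[P]_t (u t ^+ 2)%:E) => [v| |]// _; congr (_%:E).
have i1 : P.-integrable [set: T] (cst 1 : T -> \bar R).
  exact: finite_measure_integrable_cst.
have tangent k : (0 < k -> 1 + (1 - k ^- 2) / 2 * v <= k)%R.
  move=> k0; rewrite -lee_fin -[leRHS](mgf_sqr k0) EFinD EFinM -eu -integralZl//.
  have -> : 1%:E = \int[P]_t (cst 1 t).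
    by rewrite integral_cst// -[X in _ * X]/(P setT) probability_setT mule1.
  rewrite -integralD//; last exact: integrableZl.
  apply: le_integral => //.
  - by apply: integrableD => //; exact: integrableZl.
  - apply/integrableP; split; first exact/measurable_EFinP/measurable_expu2.
    under eq_integral => t _ do rewrite /= ger0_norm ?expR_ge0//.
    by rewrite mgf_sqr// ltry.
  - by move=> t _; rewrite /= -EFinM -EFinD lee_fin expR_ge1Dx.
apply: tangent_self_eq1 => //.
by rewrite -lee_fin -eu integral_ge0// => t _; rewrite lee_fin sqr_ge0.
Qed.

End normal_moments.

(** * Concentration of quadratic forms *)

Section second_moment.
Context d (T : measurableType d) (R : realType) (P : probability T R).
Local Open Scope ereal_scope.

Lemma markov_sqr (W : T -> R) (a : R) : measurable_fun [set: T] W -> (0 < a)%R ->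
  P [set t | (a < `|W t|)%R] <= (a ^- 2)%:E * \int[P]_t (W t ^+ 2)%:E.
Proof.
move=> mW a0; have a20 : (0 < a ^+ 2)%R by rewrite exprn_gt0.
rewrite -lee_pdivrMl ?invr_gt0// invrK.
have := @le_integral_comp_abse _ _ _ P _ measurableT (fun t => (W t ^+ 2)%:E) (a ^+ 2)%R
  id (@measurable_id _ _ _) (fun _ => id) (fun _ _ _ _ => id).
move=> /(_ _ a20); rewrite setTI => h.
have mW2 : measurable_fun [set: T] (fun t => (W t ^+ 2)%:E).
  by apply/measurable_EFinP; exact: measurable_funX.
rewrite (eq_integral (fun t => (W t ^+ 2)%:E)) in h; last first.
  by move=> t _; rewrite /= ger0_norm// sqr_ge0.
apply: le_trans (h mW2); rewrite lee_pmul2l// le_measure ?inE//.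
- rewrite (_ : mkset _ = (fun t => `|W t|%R) @^-1` `]a, +oo[); last first.
    by apply/seteqP; split=> t; rewrite /= in_itv/= andbT.
  by rewrite -[X in measurable X]setTI; apply: measurableT_comp.
- rewrite (_ : mkset _ = (fun t => W t ^+ 2)%R @^-1` `[(a ^+ 2)%R, +oo[); last first.
    by apply/seteqP; split=> t; rewrite /= in_itv/= andbT lee_fin ger0_norm// sqr_ge0.
  by rewrite -[X in measurable X]setTI; exact: measurable_funX.
- move=> t /= aW; rewrite lee_fin ger0_norm ?sqr_ge0// -[leRHS]real_normK ?num_real//.
  by rewrite ler_sqr ?nnegrE// ltW.
Qed.

Lemma integral_sqr_sum (I : finType) (psi : I -> T -> R) (a : I -> R) :
  (forall p q, P.-integrable [set: T] (fun t => (psi p t * psi q t)%:E)) ->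
  \int[P]_t ((\sum_p a p * psi p t) ^+ 2)%:E =
  (\sum_p \sum_q a p * a q * fine (\int[P]_t (psi p t * psi q t)%:E))%:E.
Proof.
move=> ipsi.
under eq_integral => t _.
  have -> : ((\sum_p a p * psi p t) ^+ 2)%:E =
      \sum_p \sum_q (a p * a q)%:E * (psi p t * psi q t)%:E.
    rewrite expr2 mulr_suml -sumEFin; apply: eq_bigr => p _.
    rewrite mulr_sumr -sumEFin; apply: eq_bigr => q _.
    by rewrite -EFinM mulrACA.
  over.
rewrite integral_sum//; last first.
  by move=> p; apply: integrable_sum => // q _; exact: (integrableZl measurableT _ (ipsi p q)).
rewrite -sumEFin; apply: eq_bigr => p _.
rewrite integral_sum//; last by move=> q; exact: (integrableZl measurableT _ (ipsi p q)).
rewrite -sumEFin; apply: eq_bigr => q _.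
by rewrite integralZl// [in RHS]EFinM fineK// integrable_fin_num.
Qed.

Lemma integrable_sqr_sum (I : finType) (psi : I -> T -> R) (a : I -> R) :
  (forall p q, P.-integrable [set: T] (fun t => (psi p t * psi q t)%:E)) ->
  P.-integrable [set: T] (fun t => ((\sum_p a p * psi p t) ^+ 2)%:E).
Proof.
move=> ipsi.
have sE t : ((\sum_p a p * psi p t) ^+ 2)%:E =
      \sum_p \sum_q (a p * a q)%:E * (psi p t * psi q t)%:E.
  rewrite expr2 mulr_suml -sumEFin; apply: eq_bigr => p _.
  rewrite mulr_sumr -sumEFin; apply: eq_bigr => q _.
  by rewrite -EFinM mulrACA.
under eq_fun do rewrite sE.
apply: integrable_sum => // p _; apply: integrable_sum => // q _.
exact: (integrableZl measurableT _ (ipsi p q)).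
Qed.

End second_moment.

Section quadratic_forms.
Context d (T : measurableType d) (R : realType) (P : probability T R).
Variables (n : nat) (y : T -> 'cV[R]_n) (m : 'cV[R]_n) (s : R).
Hypotheses (s_gt0 : 0 < s) (normal_y : spherical_normal P y m s).

Let e k t : R := (y t k 0 - m k 0) / s.

Let my k : measurable_fun [set: T] (fun t => y t k 0).
Proof. by case: normal_y. Qed.

Let measurable_e k : measurable_fun [set: T] (e k).
Proof. by apply: measurable_funM => //; exact: measurable_funB. Qed.

Let law_y k A : measurable A -> P ((fun t => y t k 0) @^-1` A) = normal_prob (m k 0) s A.
Proof. by case: normal_y => _ _; exact. Qed.

Let integrable_e k j : (j <= 4)%N -> P.-integrable [set: T] (fun t => (e k t ^+ j)%:E).
Proof. by move=> j4; exact: (integrable_normal_pow (my k) s_gt0 (@law_y k)). Qed.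

Let set_of (p : 'I_n * 'I_n) : {set 'I_n} := [set p.1; p.2]%SET.

(** Presents the centred product [psi p] as a product over all coordinates of one function of each,
    as [integral_prod_independent] requires. On [set_of p], which is a singleton for a diagonal
    pair, every factor has mean zero. *)
Let factor (p : 'I_n * 'I_n) (j : 'I_n) (x : R) : R :=
  if j \in set_of p then (if p.1 == p.2 then x ^+ 2 - 1 else x) else 1.

Let psi (p : 'I_n * 'I_n) t : R := e p.1 t * e p.2 t - (p.1 == p.2)%:R.

Let psiE p t : psi p t = \prod_j factor p j (e j t).
Proof.
case: p => k l; rewrite /psi /factor /set_of /=; have [->|kl] := eqVneq k l.
  rewrite (bigD1 l)//= !inE eqxx big1 ?mulr1 ?expr2// => j jl.
  by rewrite !inE (negPf jl).
rewrite subr0 (bigD1 k)//= !inE eqxx; congr (_ * _).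
rewrite (bigD1 l) 1?eq_sym//= !inE eqxx orbT big1 ?mulr1// => j /andP[jk jl].
by rewrite !inE (negPf jk) (negPf jl).
Qed.

Let factor_le p j x : `|factor p j x| <= 1 + x ^+ 2.
Proof.
rewrite /factor; have := sqr_ge0 x => x2.
case: ifP => _; last by rewrite normr1 lerDl.
case: ifP => _.
  by rewrite ler_norml; apply/andP; split; lra.
rewrite ler_norml; apply/andP; split.
  by have := sqr_ge0 (x + 1); rewrite !expr2; nra.
by have := sqr_ge0 (x - 1); rewrite !expr2; nra.
Qed.

Let measurable_factor p j : measurable_fun [set: R] (factor p j).
Proof.
rewrite /factor; case: (j \in _); case: (p.1 == p.2) => //.
by apply: measurable_funB => //; exact: measurable_funX.
Qed.

Let integrable_factor p q j :
  P.-integrable [set: T] (fun t => (factor p j (e j t) * factor q j (e j t))%:E).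
Proof.
have i1 : P.-integrable [set: T] (fun t => (2 + 2 * e j t ^+ 4)%:E).
  apply: (@integrableD _ _ _ _ _ _ (cst 2%:E) (fun t => (2 * e j t ^+ 4)%:E)) => //.
    exact: finite_measure_integrable_cst.
  exact: (integrableZl measurableT 2 (@integrable_e j 4 isT)).
apply: le_integrable i1 => //.
  by apply/measurable_EFinP; apply: measurable_funM; apply: measurableT_comp.
move=> t _; rewrite /= lee_fin [leRHS]ger0_norm; last first.
  by rewrite addr_ge0// mulr_ge0// -[4%N]/(2 * 2)%N exprM sqr_ge0.
rewrite normrM; apply: le_trans (ler_pM _ _ (factor_le p j _) (factor_le q j _)) _ => //.
by have := sqr_ge0 (e j t ^+ 2 - 1); rewrite -[4%N]/(2 * 2)%N exprM; nra.
Qed.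

Let expect_factor p j : j \in set_of p ->
  (\int[P]_t (factor p j (e j t))%:E = 0)%E.
Proof.
move=> jp; rewrite /factor jp; case: (p.1 == p.2).
  rewrite (eq_integral (fun t => (e j t ^+ 2)%:E - 1)%E)//.
  rewrite integralB//; last 2 first.
  - exact: integrable_e.
  - exact: finite_measure_integrable_cst.
  rewrite (expect_normal2 (my j) s_gt0 (@law_y j)).
  by rewrite integral_cst// -[X in (_ * X)%E]/(P setT) probability_setT mule1 subee.
exact: (expect_normal1 (my j) s_gt0 (@law_y j)).
Qed.

Let factor_notin p j x : j \notin set_of p -> factor p j x = 1.
Proof. by rewrite /factor => /negPf ->. Qed.

(** When the supports differ, some coordinate belongs to exactly one of them; there the product of
    the two factors is a single centred factor, and its zero mean annihilates the whole product. *)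
Let psi_orthogonal p q :
  P.-integrable [set: T] (fun t => (psi p t * psi q t)%:E) /\
  (set_of p != set_of q -> \int[P]_t (psi p t * psi q t)%:E = 0)%E.
Proof.
have indep : mutually_independent P (fun k t => y t k 0) by case: normal_y.
pose f j x := factor p j ((x - m j 0) / s) * factor q j ((x - m j 0) / s).
have mstd j : measurable_fun [set: R] (fun x => (x - m j 0) / s).
  by apply: measurable_funM => //; exact: measurable_funB.
have mf j : measurable_fun [set: R] (f j).
  by apply: measurable_funM; apply: measurableT_comp.
have [i1 e1] := integral_prod_independent my indep mf
  (fun k => integrable_factor p q k).
have pE t : psi p t * psi q t = \prod_j f j (y t j 0).
  by rewrite !psiE -big_split.
split; first by under eq_fun do rewrite pE.
move=> pq; under eq_integral do rewrite pE.
rewrite e1.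
have zero j : (j \in set_of p) (+) (j \in set_of q) ->
    (\int[P]_t (f j (y t j 0))%:E = 0)%E.
  rewrite /f; case: (boolP (j \in set_of p)) => jp /= jq.
    by under eq_integral do rewrite (factor_notin _ jq) mulr1; exact: expect_factor.
  by under eq_integral do rewrite (factor_notin _ jp) mul1r; exact: expect_factor.
have [j jpq] : exists j, (j \in set_of p) (+) (j \in set_of q).
  apply/existsP; apply: contraR pq => /existsPn h; apply/eqP/setP => j.
  by apply/eqP; have := h j; rewrite negb_add.
by rewrite (bigD1 j)//= zero// mul0e.
Qed.

Let integrable_psi2 p q : P.-integrable [set: T] (fun t => (psi p t * psi q t)%:E).
Proof. by have [] := psi_orthogonal p q. Qed.

Let expect_psi p : P.-integrable [set: T] (fun t => (psi p t)%:E) /\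
  (\int[P]_t (psi p t)%:E = 0)%E.
Proof.
have indep : mutually_independent P (fun k t => y t k 0) by case: normal_y.
pose f j x := factor p j ((x - m j 0) / s).
have mf j : measurable_fun [set: R] (f j).
  apply: measurableT_comp => //.
  by apply: measurable_funM => //; exact: measurable_funB.
have if_ j : P.-integrable [set: T] (fun t => (f j (y t j 0))%:E).
  have := integrable_factor p p j; rewrite /f /factor.
  have i1 : P.-integrable [set: T] (cst 1%:E) by exact: finite_measure_integrable_cst.
  case: (j \in _) => // _; case: (p.1 == p.2).
    exact: (integrableB measurableT (@integrable_e j 2 isT) i1).
  exact: (@integrable_e j 1 isT).
have [i1 e1] := integral_prod_independent my indep mf if_.
split; first by under eq_fun do rewrite psiE.
under eq_integral do rewrite psiE.
rewrite e1 (bigD1 p.1)//= expect_factor ?mul0e//.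
by rewrite !inE eqxx.
Qed.

(** Pointwise the square is at most [1 + (e_k ^ 4 + e_l ^ 4) / 2] for [p = (k, l)], whence 257 = 1 +
    128 + 128. *)
Let psi_sqr_le p : (\int[P]_t (psi p t * psi p t)%:E <= 257%:E)%E.
Proof.
pose h t := 1 + (2^-1 * e p.1 t ^+ 4 + 2^-1 * e p.2 t ^+ 4).
have i1 : P.-integrable [set: T] (cst 1%:E) by exact: finite_measure_integrable_cst.
have i4 j := integrableZl measurableT 2^-1 (@integrable_e j 4 isT).
have ih : P.-integrable [set: T] (EFin \o h).
  exact: (integrableD measurableT i1 (integrableD measurableT (i4 p.1) (i4 p.2))).
apply: (@le_trans _ _ (\int[P]_t (h t)%:E)%E).
  apply: le_integral => // t _; rewrite lee_fin /psi /h.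
  case: p {h ih} => k l /=; have [->|kl] := eqVneq k l.
    have := sqr_ge0 (e l t); rewrite mulr1n -[4%N]/(2 * 2)%N exprM -expr2 => x2.
    by rewrite -expr2; lra.
  have := sqr_ge0 (e k t ^+ 2 - e l t ^+ 2); rewrite mulr0n subr0.
  set x := e k t; set z := e l t.
  have -> : x * z * (x * z) = (x ^+ 4 + z ^+ 4) / 2 - (x ^+ 2 - z ^+ 2) ^+ 2 / 2 by field.
  lra.
rewrite (integralD measurableT i1 (integrableD measurableT (i4 p.1) (i4 p.2))).
rewrite (integralD measurableT (i4 p.1) (i4 p.2)).
rewrite integral_cst// -[X in (_ * X + _)%E]/(P setT) probability_setT mule1.
rewrite !integralZl//; [|exact: (@integrable_e _ 4)..].
have h4 k := expect_normal4_le (my k) s_gt0 (@law_y k).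
have : (1%:E + ((2^-1)%:E * 256%:E + (2^-1)%:E * 256%:E) <= 257%:E :> \bar R)%E.
  by rewrite -!EFinM -!EFinD lee_fin; lra.
move/(le_trans _); apply; rewrite leeD2l//.
by apply: leeD; rewrite lee_pmul2l//; exact: h4.
Qed.

Let swap (p : 'I_n * 'I_n) := (p.2, p.1).

Let set_of_eq p q : set_of p = set_of q -> (q == p) || (q == swap p).
Proof.
case: p q => k l [i j] /setP; rewrite /set_of /swap /= => h.
have := h l; have := h k; have := h j; have := h i.
rewrite !inE !eqxx !orbT /= !xpair_eqE.
move=> /orP[]/eqP-> /orP[]/eqP->; rewrite ?eqxx ?orbT//= => hk hl.
  by rewrite andbT orbb eq_sym -[l == k]orbb -hl.
by rewrite andbT orbb eq_sym -[k == l]orbb -hk.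
Qed.

Let psi_swap p t : psi (swap p) t = psi p t.
Proof. by rewrite /psi /swap /= mulrC eq_sym. Qed.

Variable A : 'M[R]_n.
Hypotheses (symA : A^T = A) (idemA : A *m A = A).

(** With [y = m + s e], the form [y' A y / s ^+ 2] splits into its mean [\tr A + v], a centred
    quadratic part [Q] and a cross term [2 * L]; [v] is the noncentrality. *)
Let Q t := \sum_p A p.1 p.2 * psi p t.

Let b k := (A *m m) k 0 / s.
Let L t := \sum_k b k * e k t.
Let v := (m^T *m A *m m) 0 0 / s ^+ 2.

(** The squared Frobenius norm of an orthogonal projection is its trace. This is why the variance of
    [Q] grows linearly in the residual degrees of freedom. *)
Let trA : \sum_(p : 'I_n * 'I_n) A p.1 p.2 ^+ 2 = \tr A.
Proof.
rewrite -[in RHS]idemA /mxtrace.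
under [RHS]eq_bigr do rewrite mxE.
rewrite [RHS]pair_bigA /=; apply: eq_bigr => -[k l] _ /=.
by rewrite expr2 -[in X in _ = _ * X]symA mxE.
Qed.

Let integrable_Q2 : P.-integrable [set: T] (fun t => (Q t ^+ 2)%:E).
Proof. exact: integrable_sqr_sum. Qed.

(** By orthogonality, in the row of [p] only [p] and [swap p] contribute, each at most 257 times the
    squared entry; hence 514. *)
Let expect_Q : (\int[P]_t (Q t ^+ 2)%:E <= (514 * \tr A)%:E)%E.
Proof.
rewrite integral_sqr_sum// lee_fin -trA mulr_sumr; apply: ler_sum => p _.
pose c q := fine (\int[P]_t (psi p t * psi q t)%:E)%E.
have /andP[cp0 cp1] : 0 <= c p <= 257.
  apply/andP; split.
    by rewrite fine_ge0// integral_ge0// => t _; rewrite lee_fin -expr2 sqr_ge0.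
  by rewrite -lee_fin fineK ?psi_sqr_le// integrable_fin_num.
set a := A p.1 p.2; have a2 := sqr_ge0 a.
have cle q : a * A q.1 q.2 * c q <=
    (q == p)%:R * (257 * a ^+ 2) + (q == swap p)%:R * (257 * a ^+ 2).
  have [|pq] := eqVneq (set_of p) (set_of q); last first.
    rewrite /c (proj2 (psi_orthogonal p q))//= mulr0.
    by rewrite addr_ge0// mulr_ge0// mulr_ge0.
  have : a * a * c p <= 257 * a ^+ 2 by rewrite -expr2 mulrC ler_wpM2r.
  have a20 : 0 <= 257 * a ^+ 2 by rewrite mulr_ge0.
  move=> h /set_of_eq /orP[]/eqP ->.
    rewrite eqxx mul1r (le_trans h)// lerDl mulr_ge0//.
  have -> : A (swap p).1 (swap p).2 = a by rewrite -[in LHS]symA mxE.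
  have -> : c (swap p) = c p.
    by rewrite /c; congr fine; apply: eq_integral => t _; rewrite psi_swap.
  by rewrite eqxx mul1r (le_trans h)// lerDr mulr_ge0.
have sum1 q x : \sum_(q0 : 'I_n * 'I_n) (q0 == q)%:R * x = x :> R.
  by rewrite (bigD1 q)//= eqxx mul1r big1 ?addr0// => q0 /negPf->; rewrite mul0r.
apply: le_trans (ler_sum _ (fun q _ => cle q)) _.
by rewrite big_split /= !sum1; lra.
Qed.

Let expect_e2 k l : P.-integrable [set: T] (fun t => (e k t * e l t)%:E) /\
  (\int[P]_t (e k t * e l t)%:E = (k == l)%:R%:E)%E.
Proof.
have [i1 e1] := expect_psi (k, l).
have i2 : P.-integrable [set: T] (cst (k == l)%:R%:E) by exact: finite_measure_integrable_cst.
have eE t : (e k t * e l t)%:E = ((psi (k, l) t)%:E + (k == l)%:R%:E)%E.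
  by rewrite -EFinD /psi/= subrK.
split; first by under eq_fun do rewrite eE; exact: (integrableD measurableT i1 i2).
under eq_integral do rewrite eE.
rewrite (integralD measurableT i1 i2) e1 add0e.
by rewrite integral_cst// -[X in (_ * X)%E]/(P setT) probability_setT mule1.
Qed.

Let expect_L : (\int[P]_t (L t ^+ 2)%:E = v%:E)%E.
Proof.
rewrite integral_sqr_sum; last by move=> k l; have [] := expect_e2 k l.
congr EFin; under eq_bigr => k _.
  rewrite (bigD1 k)//= (proj2 (expect_e2 k k)) eqxx mulr1 big1 ?addr0; last first.
    by move=> l kl; rewrite (proj2 (expect_e2 k l)) eq_sym (negPf kl) mulr0.
  over.
rewrite /v -[in RHS]idemA -{1}symA !mulmxA -trmx_mul -mulmxA mxE mulr_suml.
by apply: eq_bigr => k _; rewrite mxE /b; field; rewrite gt_eqF.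
Qed.

Let integrable_L2 : P.-integrable [set: T] (fun t => (L t ^+ 2)%:E).
Proof. by apply: integrable_sqr_sum => k l; have [] := expect_e2 k l. Qed.

Let decomposition t : ((y t)^T *m A *m y t) 0 0 / s ^+ 2 =
  \tr A + v + (Q t + 2 * L t).
Proof.
pose E := \col_k e k t.
have yE : y t = m + s *: E.
  by apply/colP => k; rewrite !mxE /e mulrC divfK ?gt_eqF// addrC subrK.
have EAE : (E^T *m A *m E) 0 0 = \tr A + Q t.
  rewrite mxE /Q /psi.
  under eq_bigr => l _ do rewrite mxE mulr_suml.
  rewrite exchange_big /= pair_bigA /=.
  rewrite /mxtrace.
  have -> : \sum_i A i i = \sum_(p : 'I_n * 'I_n) A p.1 p.2 * (p.1 == p.2)%:R.
    rewrite -(pair_bigA _ (fun k l => A k l * (k == l)%:R)) /=.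
    apply: eq_bigr => k _; rewrite (bigD1 k)//= eqxx mulr1 big1 ?addr0// => l lk.
    by rewrite eq_sym (negPf lk) mulr0.
  rewrite -big_split; apply: eq_bigr => -[k l] _ /=.
  by rewrite !mxE; ring.
have mAE : (m^T *m A *m E) 0 0 = s * L t.
  rewrite -{1}symA -trmx_mul mxE mulr_sumr; apply: eq_bigr => k _.
  by rewrite mxE [E k 0]mxE /b; field; rewrite gt_eqF.
have EAm : (E^T *m A *m m) 0 0 = s * L t.
  rewrite -mAE -[m^T *m A *m E]trmxK [in RHS]mxE.
  by rewrite trmx_mul trmx_mul trmxK symA mulmxA.
have -> : (y t)^T *m A *m y t = m^T *m A *m m + s *: (m^T *m A *m E) +
    (s *: (E^T *m A *m m) + (s * s) *: (E^T *m A *m E)).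
  rewrite yE [(_ + _)^T]linearD /= [(_ *: _)^T]linearZ /= !mulmxDl !mulmxDr.
  by rewrite -!scalemxAr -!scalemxAl scalerA.
rewrite mxE [X in X + _]mxE [X in _ + X]mxE [X in _ + X + _]mxE [X in _ + (X + _)]mxE.
rewrite [X in _ + (_ + X)]mxE mAE EAm EAE /v; field.
by rewrite gt_eqF.
Qed.

(** Chebyshev's inequality for [Q + 2 * L], whose square is at most [2 * Q ^+ 2 + 8 * L ^+ 2]; this
    avoids the covariance of [Q] and [L] and explains 1028 and 8. *)
Lemma quadratic_form_concentration (eta : R) : 0 < eta ->
  (P [set t | (eta < `|((y t)^T *m A *m y t) 0 0 / s ^+ 2 - (\tr A + v)|)%R] <=
   (eta ^- 2 * (1028 * \tr A + 8 * v))%:E)%E.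
Proof.
move=> eta0; pose W t := Q t + 2 * L t.
have mW : measurable_fun [set: T] W.
  apply: measurable_funD.
    apply: measurable_sum => p; apply: measurable_funM => //.
    by apply: measurable_funB => //; exact: measurable_funM.
  apply: measurable_funM => //; apply: measurable_sum => k.
  exact: measurable_funM.
rewrite (_ : mkset _ = [set t | eta < `|W t|]); last first.
  by apply/seteqP; split=> t /=; rewrite decomposition addrC addKr.
apply: le_trans; first exact: markov_sqr mW eta0.
rewrite EFinM lee_pmul2l// ?lte_fin ?invr_gt0 ?exprn_gt0//.
have i2 := integrableZl measurableT 2 integrable_Q2.
have i8 := integrableZl measurableT 8 integrable_L2.
apply: (@le_trans _ _ (\int[P]_t (2%:E * (Q t ^+ 2)%:E + 8%:E * (L t ^+ 2)%:E))%E).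
  apply: ge0_le_integral => //.
  - by move=> t _; rewrite lee_fin sqr_ge0.
  - by apply/measurable_EFinP; exact: measurable_funX.
  - exact: measurable_int (integrableD measurableT i2 i8).
  - move=> t _; rewrite -!EFinM -EFinD lee_fin /W.
    have := sqr_ge0 (Q t - 2 * L t); nra.
rewrite (integralD measurableT i2 i8) !integralZl// expect_L.
apply: (@le_trans _ _ (2%:E * (514 * \tr A)%:E + 8%:E * v%:E)%E).
  by apply: leeD => //; rewrite lee_pmul2l.
by rewrite -!EFinM -EFinD lee_fin; lra.
Qed.

End quadratic_forms.

(** * Residual projections *)

Section hat_matrix.
Variable R : realType.

Lemma sqr_norm_eq0 n (w : 'rV[R]_n) : (w *m w^T) 0 0 = 0 -> w = 0.
Proof.
rewrite mxE => w0; apply/rowP => k; rewrite !mxE.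
have : \sum_j w 0 j ^+ 2 = 0.
  by rewrite -[RHS]w0; apply: eq_bigr => j _; rewrite mxE expr2.
move/eqP; rewrite psumr_eq0; last by move=> j _; exact: sqr_ge0.
by move/allP => /(_ k); rewrite mem_index_enum sqrf_eq0 => /(_ isT)/eqP.
Qed.

Lemma gram_unit n k (X : 'M[R]_(n, k)) : \rank X = k -> X^T *m X \in unitmx.
Proof.
move=> rX; rewrite -row_free_unit; apply: inj_row_free => u uXX.
have fX : row_free X^T by rewrite /row_free mxrank_tr rX.
apply: (row_free_inj fX); rewrite mul0mx; apply: sqr_norm_eq0.
by rewrite trmx_mul trmxK [u *m _ *m _]mulmxA -(mulmxA u) uXX mul0mx mxE.
Qed.

Section residual.
Variables (n k : nat) (X : 'M[R]_(n, k)).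
Hypothesis rX : \rank X = k.

Let A := 1%:M - hat_mx X.

Lemma hat_mx_tr : (hat_mx X)^T = hat_mx X.
Proof. by rewrite /hat_mx !trmx_mul trmx_inv trmx_mul !trmxK mulmxA. Qed.

Lemma hat_mx_id : hat_mx X *m X = X.
Proof. by rewrite /hat_mx -!mulmxA mulVmx ?gram_unit// mulmx1. Qed.

Lemma residual_mx_tr : A^T = A.
Proof. by rewrite /A linearB /= trmx1 hat_mx_tr. Qed.

Lemma residual_mx_design : A *m X = 0.
Proof. by rewrite mulmxBl mul1mx hat_mx_id subrr. Qed.

Lemma residual_mx_idem : A *m A = A.
Proof.
rewrite {2}/A mulmxBr mulmx1 [X in A *m X]/hat_mx 2!mulmxA residual_mx_design.
by rewrite !mul0mx subr0.
Qed.

Lemma mxtrace_residual : \tr A = n%:R - k%:R.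
Proof.
rewrite /A linearB /= mxtrace1 /hat_mx -mulmxA mxtrace_mulC -mulmxA.
by rewrite mulVmx ?gram_unit// mxtrace1.
Qed.

Lemma residual_form_ge0 (z : 'cV[R]_n) : 0 <= (z^T *m A *m z) 0 0.
Proof.
have -> : z^T *m A *m z = (A *m z)^T *m (A *m z).
  by rewrite trmx_mul residual_mx_tr -[in LHS]residual_mx_idem !mulmxA.
by rewrite mxE sumr_ge0// => j _; rewrite mxE -expr2 sqr_ge0.
Qed.

End residual.

(** A vanishing combination of the selected columns is one of all columns, with the coefficients
    placed along [f]; injectivity allows them to be read back. *)
Lemma mxrank_colsub n k l (f : 'I_l -> 'I_k) (X : 'M[R]_(n, k)) :
  injective f -> \rank X = k -> \rank (colsub f X) = l.
Proof.
move=> f_inj rX; rewrite -mxrank_tr; apply/eqP/inj_row_free => v.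
have fX : row_free X^T by rewrite /row_free mxrank_tr rX.
have -> : (colsub f X)^T = rowsub f 1%:M *m X^T.
  by rewrite mul_rowsub_mx mul1mx trmx_mxsub.
rewrite mulmxA -(mul0mx _ X^T) => /(row_free_inj fX) v0.
apply/rowP => j; have := congr1 (fun w : 'rV_k => w 0 (f j)) v0.
rewrite !mxE => <-; rewrite (bigD1 j)//= !mxE eqxx mulr1 big1 ?addr0// => i ij.
by rewrite !mxE (inj_eq f_inj) (negPf ij) mulr0.
Qed.

End hat_matrix.

(** * Bounds for the Bayes factor *)

Section bayes_factor_bounds.
Variable R : realType.
Variables (n p i : nat).
Hypotheses (ip : (i < p)%N) (pn : (p < n)%N).
Implicit Types B b s phi : R.

Local Notation mu := (@lebesgue_measure R).

Definition bf_integrand B phi : R :=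
  sin phi ^+ (p - i) *
  (n%:R + (p%:R + 1) * sin phi ^+ 2) `^ ((n%:R - p%:R) / 2) /
  (n%:R * B + (p%:R + 1) * sin phi ^+ 2) `^ ((n%:R - i%:R) / 2).

Definition bf_of_ratio B : R :=
  2 / pi * (p%:R + 1) `^ ((p%:R - i%:R) / 2) *
  \int[mu]_(phi in `[0, pi / 2]) bf_integrand B phi.

Let kap : R := (p%:R + 1) / n%:R.

(* [2 / n] times the logarithm of the normalised integrand at [sin phi ^+ 2 = s]. *)
Definition bf_exponent B s : R :=
  (p%:R - i%:R) / n%:R * ln (kap * s) +
  (n%:R - p%:R) / n%:R * ln (1 + kap * s) -
  (n%:R - i%:R) / n%:R * ln (B + kap * s).

Let n0 : 0 < n%:R :> R. Proof. by rewrite ltr0n (leq_ltn_trans _ pn). Qed.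
Let n_neq0 : n%:R != 0 :> R. Proof. by rewrite gt_eqF. Qed.
Let p1 : 0 < p%:R + 1 :> R. Proof. by rewrite ltr_wpDl. Qed.
Let kap0 : 0 < kap. Proof. by rewrite divr_gt0. Qed.

Let cst_pos : 0 < (p%:R + 1) `^ ((p%:R - i%:R) / 2) :> R.
Proof. exact: powR_gt0. Qed.

Lemma bf_integrand_ge0 B phi : 0 <= phi <= pi / 2 -> 0 <= bf_integrand B phi.
Proof.
move=> /andP[phi0 phi1]; rewrite /bf_integrand divr_ge0 ?powR_ge0//.
rewrite mulr_ge0 ?powR_ge0// exprn_ge0// sin_ge0_pi// phi0/= (le_trans phi1)//.
by have := pi_gt0 R; lra.
Qed.

(** The power of [p + 1] in front pairs with the power of the sine. Every base is then [n] times a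
    normalised quantity, and the powers of [n] cancel because [(p - i) + (n - p) = n - i]. *)
Lemma bf_integrandE B phi : 0 < B -> 0 < sin phi ->
  (p%:R + 1) `^ ((p%:R - i%:R) / 2) * bf_integrand B phi =
  expR (n%:R / 2 * bf_exponent B (sin phi ^+ 2)).
Proof.
move=> B0 s0; rewrite /bf_integrand.
have s20 : 0 < sin phi ^+ 2 by rewrite exprn_gt0.
have ks0 : 0 < kap * sin phi ^+ 2 by rewrite mulr_gt0.
have eN : n%:R + (p%:R + 1) * sin phi ^+ 2 = n%:R * (1 + kap * sin phi ^+ 2).
  by rewrite /kap; field.
have eB : n%:R * B + (p%:R + 1) * sin phi ^+ 2 = n%:R * (B + kap * sin phi ^+ 2).
  by rewrite /kap; field.
rewrite eN eB.
have -> : sin phi ^+ (p - i) = (sin phi ^+ 2) `^ ((p%:R - i%:R) / 2).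
  rewrite -natrB ?(ltnW ip)// -powR_mulrn ?ltW// -powR_mulrn ?sqr_ge0 ?ltW//.
  by rewrite -powRrM; congr powR; lra.
rewrite mulrA mulrA -powRM ?ltW//.
have -> : (p%:R + 1) * sin phi ^+ 2 = n%:R * (kap * sin phi ^+ 2).
  by rewrite /kap; field.
have pE (x a : R) : 0 < x -> (n%:R * x) `^ a = expR (a * (ln n%:R + ln x)).
  by move=> x0; rewrite /powR gt_eqF ?mulr_gt0// lnM ?posrE.
rewrite !pE ?ltr_wpDl ?addr_gt0 ?ltW// -expRN -!expRD.
by congr expR; rewrite /bf_exponent; field.
Qed.

Lemma bf_integrand0 B : bf_integrand B 0 = 0.
Proof. by rewrite /bf_integrand sin0 expr0n subn_eq0 leqNgt ip !mul0r. Qed.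

(* Both logarithms are compared with their tangents at [s = 1]. *)
Lemma bf_exponent_le B s : 0 < B -> 0 < s <= 1 ->
  (n%:R - p%:R) * (B + kap) <= (n%:R - i%:R) * B * (1 + kap) ->
  bf_exponent B s <= bf_exponent B 1.
Proof.
move=> B0 /andP[s0 s1] h.
have ks0 : 0 < kap * s by rewrite mulr_gt0.
have Bk0 : 0 < B + kap by rewrite addr_gt0.
have Bks0 : 0 < B + kap * s by rewrite addr_gt0.
have k1 : 0 < 1 + kap by rewrite addr_gt0.
have ks1 : 0 < 1 + kap * s by rewrite addr_gt0.
have ln_tangent (x : R) : 0 < x -> ln x <= x - 1.
  by move=> x0; have := @le_ln1Dx R (x - 1); rewrite [1 + _]addrC subrK; apply; lra.
set a := (p%:R - i%:R) / n%:R : R; set b := (n%:R - p%:R) / n%:R : R.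
have a0 : 0 <= a by rewrite divr_ge0 ?subr_ge0 ?ler_nat// ltnW.
have b0 : 0 <= b by rewrite divr_ge0 ?subr_ge0 ?ler_nat// ltnW.
(* Splitting the weight of [ln (B + kap * s)] into [a] and [b] writes the difference of the
   exponents at [s] and 1 as two weighted logarithms of ratios that equal 1 at [s = 1]. *)
have cE : (n%:R - i%:R) / n%:R = a + b :> R by rewrite /a /b; field.
have h' : b * (B + kap) <= (a + b) * B * (1 + kap).
  have -> : b * (B + kap) = (n%:R - p%:R) * (B + kap) / n%:R by rewrite /b; ring.
  have -> : (a + b) * B * (1 + kap) = (n%:R - i%:R) * B * (1 + kap) / n%:R.
    by rewrite -cE; ring.
  by rewrite ler_pM2r ?invr_gt0.
rewrite /bf_exponent cE -/a -/b mulr1.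
have := ln_tangent (s * (B + kap) / (B + kap * s)).
have := ln_tangent ((1 + kap * s) * (B + kap) / ((1 + kap) * (B + kap * s))).
rewrite !divr_gt0 ?mulr_gt0// => /(_ isT) h2 /(_ isT) h1.
have hs := lerD (ler_wpM2l a0 h1) (ler_wpM2l b0 h2).
rewrite -subr_le0; apply: le_trans (_ : _ <= a * (s * (B + kap) / (B + kap * s) - 1) +
  b * ((1 + kap * s) * (B + kap) / ((1 + kap) * (B + kap * s)) - 1)) _.
  apply: le_trans hs.
  have -> : ln (kap * s) = ln kap + ln s by rewrite lnM ?posrE.
  rewrite !ln_div ?posrE ?mulr_gt0//.
  have -> : ln (s * (B + kap)) = ln s + ln (B + kap) by rewrite lnM ?posrE.
  have -> : ln ((1 + kap * s) * (B + kap)) = ln (1 + kap * s) + ln (B + kap).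
    by rewrite lnM ?posrE.
  have -> : ln ((1 + kap) * (B + kap * s)) = ln (1 + kap) + ln (B + kap * s).
    by rewrite lnM ?posrE.
  by rewrite le_eqVlt; apply/orP; left; apply/eqP; ring.
set rhs := (X in X <= _).
(* The sum of the two linear bounds has the factor [1 - s]; the sign of the remaining factor is the
   hypothesis. *)
have -> : rhs = (1 - s) * (b * (B + kap) - (a + b) * B * (1 + kap)) /
   ((1 + kap) * (B + kap * s)).
  by rewrite /rhs; field; rewrite !gt_eqF.
rewrite pmulr_lle0 ?invr_gt0 ?mulr_gt0// mulr_ge0_le0 ?subr_ge0// subr_le0.
exact: h'.
Qed.

Lemma bf_exponent_le_ratio B B' s : 0 < B -> B <= B' -> 0 < s ->
  bf_exponent B' s <= bf_exponent B s.
Proof.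
move=> B0 BB' s0; have ks0 : 0 < kap * s by rewrite mulr_gt0.
rewrite /bf_exponent lerD2l lerN2 ler_wpM2l//.
  by rewrite divr_ge0 ?subr_ge0 ?ler_nat// ltnW// (ltn_trans ip).
rewrite ler_ln ?posrE ?addr_gt0 ?lerD2r// (lt_le_trans B0)//.
Qed.

Let piN0 : pi != 0 :> R. Proof. by rewrite gt_eqF// pi_gt0. Qed.

Let sin_range phi : 0 <= phi <= pi / 2 -> phi = 0 \/ 0 < sin phi <= 1.
Proof.
move=> /andP[]; rewrite le_eqVlt => /predU1P[<- _|phi0 phi1]; first by left.
right; rewrite sin_le1 andbT sin_gt0_pi// phi0/= (le_lt_trans phi1)//.
by have := pi_gt0 R; lra.
Qed.

Let sin2_range phi : 0 < sin phi <= 1 -> 0 < sin phi ^+ 2 <= 1.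
Proof. by move=> /andP[s0 s1]; rewrite exprn_gt0//= expr_le1// ltW. Qed.

Lemma measurable_bf_integrand :
  measurable_fun [set: R * R] (fun z => bf_integrand z.1 z.2).
Proof.
have ms : measurable_fun [set: R * R] (fun z => sin z.2).
  apply: measurableT_comp measurable_snd.
  by apply: continuous_measurable_fun; exact: continuous_sin.
rewrite /bf_integrand; apply: measurable_funM.
  apply: measurable_funM; first exact: measurable_funX.
  apply: (@measurableT_comp _ _ _ _ _ _ (fun x => x `^ _)); first exact: measurable_powR.
  by apply: measurable_funD => //; apply: measurable_funM => //; exact: measurable_funX.
under eq_fun do rewrite -powRN.
apply: (@measurableT_comp _ _ _ _ _ _ (fun x => x `^ _)); first exact: measurable_powR.
apply: measurable_funD; first by apply: measurable_funM.
by apply: measurable_funM => //; exact: measurable_funX.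
Qed.

Lemma measurable_bf_integrand2 B : measurable_fun [set: R] (bf_integrand B).
Proof.
exact: (measurableT_comp measurable_bf_integrand (pair1_measurable B)).
Qed.

Let bound B phi : 0 < B -> 0 <= phi <= pi / 2 ->
  (n%:R - p%:R) * (B + kap) <= (n%:R - i%:R) * B * (1 + kap) ->
  bf_integrand B phi <= expR (n%:R / 2 * bf_exponent B 1) /
     (p%:R + 1) `^ ((p%:R - i%:R) / 2).
Proof.
move=> B0 phi02 h; rewrite ler_pdivlMr// mulrC.
have [->|/[dup] s01 /andP[s0 s1]] := sin_range phi02.
  by rewrite bf_integrand0 mulr0 expR_ge0.
rewrite bf_integrandE// ler_expR ler_wpM2l ?divr_ge0//.
by rewrite bf_exponent_le// sin2_range.
Qed.

Let mu_itv a b : a <= b -> mu `[a, b] = (b - a)%:E.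
Proof.
rewrite le_eqVlt => /predU1P[->|ab]; last by rewrite lebesgue_measure_itv/= lte_fin ab.
by rewrite set_itv1 lebesgue_measure_set1 subrr.
Qed.

Let integrable_bf B : 0 < B -> mu.-integrable `[0, pi / 2] (EFin \o bf_integrand B).
Proof.
move=> B0; have pi2 : 0 <= pi / 2 :> R by have := pi_gt0 R; lra.
pose K := (n%:R + (p%:R + 1)) `^ ((n%:R - p%:R) / 2) /
  (n%:R * B) `^ ((n%:R - i%:R) / 2).
have iK : mu.-integrable `[0, pi / 2] (EFin \o cst K).
  apply: measurable_bounded_integrable => //.
    by rewrite /= mu_itv// ltry.
  exact: bounded_cst.
apply: le_integrable iK => //.
  by apply/measurable_EFinP/measurable_funTS; exact: measurable_bf_integrand2.
move=> phi; rewrite /= in_itv/= => phi02; rewrite lee_fin.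
have nip : 0 <= (n%:R - p%:R) / 2 :> R by rewrite divr_ge0 ?subr_ge0 ?ler_nat// ltnW.
have nii : 0 <= (n%:R - i%:R) / 2 :> R.
  by rewrite divr_ge0 ?subr_ge0 ?ler_nat// ltnW// (ltn_trans ip).
rewrite ger0_norm ?bf_integrand_ge0// ger0_norm ?divr_ge0 ?powR_ge0//.
rewrite /bf_integrand.
have [->|/[dup] /sin2_range/andP[s20 s21] /andP[s0 s1]] := sin_range phi02.
  by rewrite sin0 expr0n subn_eq0 leqNgt ip !mul0r divr_ge0 ?powR_ge0.
have s0' := ltW s0; have p1' := ltW p1; have s20' := ltW s20; have B0' := ltW B0.
apply: ler_pM; rewrite ?invr_ge0 ?mulr_ge0 ?powR_ge0 ?exprn_ge0//.
  rewrite -[leRHS]mul1r; apply: ler_pM; rewrite ?powR_ge0 ?exprn_ge0//.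
  apply: ge0_ler_powR => //; rewrite ?nnegrE ?addr_ge0 ?mulr_ge0//.
  by rewrite lerD2l ler_piMr.
rewrite lef_pV2 ?posrE ?powR_gt0 ?addr_gt0 ?mulr_gt0//.
apply: ge0_ler_powR => //; rewrite ?nnegrE ?addr_ge0 ?mulr_ge0//.
by rewrite lerDl mulr_ge0.
Qed.

Let bf_norm : 0 < 2 / pi * (p%:R + 1) `^ ((p%:R - i%:R) / 2) :> R.
Proof. by rewrite mulr_gt0// divr_gt0// pi_gt0. Qed.

Lemma bf_of_ratio_ge0 B : 0 <= bf_of_ratio B.
Proof.
rewrite /bf_of_ratio mulr_ge0 ?(ltW bf_norm)//.
by apply: Rintegral_ge0 => phi; rewrite /= in_itv/=; exact: bf_integrand_ge0.
Qed.

Lemma bf_of_ratio_le B : 0 < B ->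
  (n%:R - p%:R) * (B + kap) <= (n%:R - i%:R) * B * (1 + kap) ->
  bf_of_ratio B <= expR (n%:R / 2 * bf_exponent B 1).
Proof.
move=> B0 h; have pi2 : 0 < pi / 2 :> R by have := pi_gt0 R; lra.
pose c : R := (p%:R + 1) `^ ((p%:R - i%:R) / 2).
have c0 : 0 < c by exact: cst_pos.
pose K := expR (n%:R / 2 * bf_exponent B 1) / c.
have -> : expR (n%:R / 2 * bf_exponent B 1) = 2 / pi * c * (K * (pi / 2)).
  rewrite /K; move: piN0; move: (pi : R) => q q0.
  by field; rewrite q0 gt_eqF.
rewrite /bf_of_ratio ler_pM2l// -/c.
have <- : \int[mu]_(phi in `[0, pi / 2]) K = K * (pi / 2).
  by rewrite Rintegral_cst//= mu_itv ?ltW//= subr0.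
apply: le_Rintegral => //; first exact: integrable_bf.
  apply: measurable_bounded_integrable => //; last exact: bounded_cst.
  by rewrite /= mu_itv ?ltW// ltry.
by move=> phi; rewrite /= in_itv/= => phi02; exact: bound.
Qed.

(** A lower bound for [bf_exponent B] valid at once for all [B] up to [b] and all squared sines
    between [s] and 1: the increasing terms are taken at [s], the subtracted one at its largest. *)
Definition bf_lower_exponent b s : R :=
  (p%:R - i%:R) / n%:R * ln (kap * s) +
  (n%:R - p%:R) / n%:R * ln (1 + kap * s) -
  (n%:R - i%:R) / n%:R * ln (b + kap).

(** Moving from 1 to [s] costs at most [ln s] in each of the first two logarithms, and their weights
    sum to [(n - i) / n], which is at most 1. *)
Lemma bf_lower_exponent_ge b s : 0 < s <= 1 ->
  bf_exponent b 1 + ln s <= bf_lower_exponent b s.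
Proof.
move=> /andP[s0 s1]; rewrite /bf_exponent /bf_lower_exponent !mulr1.
have k1 : 0 < 1 + kap by rewrite addr_gt0.
have ks0 : 0 < kap * s by rewrite mulr_gt0.
have h1 : ln (1 + kap) + ln s <= ln (1 + kap * s).
  by rewrite -lnM ?posrE// ler_ln ?posrE ?mulr_gt0 ?addr_gt0//; lra.
have h2 := ln_le0 s1.
have -> : ln (kap * s) = ln kap + ln s by rewrite lnM ?posrE.
set a := (p%:R - i%:R) / n%:R : R; set c := (n%:R - p%:R) / n%:R : R.
have c0 : 0 <= c by rewrite divr_ge0 ?subr_ge0 ?ler_nat// ltnW.
have ac : a + c <= 1.
  rewrite (_ : a + c = (n%:R - i%:R) / n%:R); last by rewrite /a /c; field.
  by rewrite ler_pdivrMr// mul1r gerBl.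
have h3 := ler_wpM2l c0 h1.
have h4 : 0 <= (1 - (a + c)) * - ln s by rewrite mulr_ge0 ?oppr_ge0 ?subr_ge0.
lra.
Qed.

(** Only the part of the integral over [[phi0, pi / 2]] is kept; the first factor is the share of
    this interval in the whole range. *)
Lemma bf_of_ratio_ge B b phi0 : 0 < B <= b -> 0 < phi0 < pi / 2 ->
  (1 - 2 / pi * phi0) * expR (n%:R / 2 * bf_lower_exponent b (sin phi0 ^+ 2)) <=
  bf_of_ratio B.
Proof.
move=> /andP[B0 Bb] /andP[phi00 phi01].
have pi0 := pi_gt0 R.
have pi2 : 0 < pi / 2 :> R by lra.
pose c : R := (p%:R + 1) `^ ((p%:R - i%:R) / 2).
have c0 : 0 < c by exact: cst_pos.
set E := expR _; pose K := E / c.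
have -> : (1 - 2 / pi * phi0) * E = 2 / pi * c * (K * (pi / 2 - phi0)).
  rewrite /K; move: piN0; move: (pi : R) => q q0.
  by field; rewrite q0 gt_eqF.
rewrite /bf_of_ratio ler_pM2l// -/c -lee_fin fineK; last first.
  by apply: integrable_fin_num => //; exact: integrable_bf.
have sub : `[phi0, pi / 2] `<=` `[0, pi / 2].
  by apply: subset_itvr; rewrite bnd_simp ltW.
apply: (@le_trans _ _ (\int[mu]_(phi in `[phi0, (pi / 2)%R]) (bf_integrand B phi)%:E)%E);
  last first.
  apply: ge0_subset_integral => //.
    by apply/measurable_EFinP/measurable_funTS; exact: measurable_bf_integrand2.
  by move=> phi; rewrite /= in_itv/= lee_fin; exact: bf_integrand_ge0.
rewrite EFinM -(mu_itv (ltW phi01)) -integral_cst//.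
apply: ge0_le_integral => //.
- by move=> phi _; rewrite lee_fin divr_ge0 ?expR_ge0 ?ltW.
- by apply/measurable_EFinP/measurable_funTS; exact: measurable_bf_integrand2.
move=> phi; rewrite /= in_itv/= => /andP[phi1 phi2]; rewrite lee_fin.
rewrite /K ler_pdivrMr// [leRHS]mulrC.
have phi02 : 0 <= phi <= pi / 2 by rewrite phi2 andbT (le_trans _ phi1)// ltW.
have [phi_0|/[dup] /sin2_range/andP[s20 s21] /andP[s0 s1]] := sin_range phi02.
  by move: phi1; rewrite phi_0 leNgt phi00.
have ss : 0 < sin phi0 <= sin phi.
  rewrite sin_gt0_pi ?phi00/=; last lra.
  by rewrite leNgt ltr_sin ?in_itv/= -?leNgt//; apply/andP; split; lra.
have [ss0 ss1] := andP ss.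
have sq0 : 0 < sin phi0 ^+ 2 by rewrite exprn_gt0.
have sq : sin phi0 ^+ 2 <= sin phi ^+ 2 by rewrite ler_sqr ?nnegrE// ltW.
rewrite bf_integrandE// /E ler_expR ler_wpM2l ?divr_ge0//.
have ip' := ltnW ip; have pn' := ltnW pn; have in' := ltnW (ltn_trans ip pn).
have b0 : 0 < b := lt_le_trans B0 Bb.
have ks := mulr_gt0 kap0 s20; have ks0 := mulr_gt0 kap0 sq0.
rewrite /bf_lower_exponent /bf_exponent.
apply: lerB; first apply: lerD; apply: ler_wpM2l;
  rewrite ?divr_ge0 ?subr_ge0 ?ler_nat// ler_ln ?posrE ?addr_gt0//.
- by rewrite ler_pM2l.
- by rewrite lerD2l ler_pM2l.
- by rewrite lerD// ler_piMr// ltW.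
Qed.

Lemma measurable_bf_of_ratio : measurable_fun [set: R] bf_of_ratio.
Proof.
apply: measurable_funM => //.
(* The sine may be negative outside the range of integration; the indicator makes the joint
   integrand nonnegative everywhere, as the Tonelli argument demands. *)
pose f (z : R * R) := (\1_`[0, pi / 2] z.2 * bf_integrand z.1 z.2)%:E.
have -> : (fun B => \int[mu]_(phi in `[0, pi / 2]) bf_integrand B phi) =
    fine \o (fubini_F mu f).
  apply/funext => B; rewrite /Rintegral /fubini_F /= integral_mkcond.
  congr fine; apply: eq_integral => phi _; rewrite /f /patch /= indicE.
  by case: ifPn; rewrite ?mul1r ?mul0r.
apply: measurableT_comp => //.
apply: measurable_fun_fubini_tonelli_F.
  apply/measurable_EFinP; apply: measurable_funM; last exact: measurable_bf_integrand.
  exact: measurableT_comp measurable_snd.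
move=> [B phi]; rewrite lee_fin /= indicE.
have [|_] := boolP (phi \in _); last by rewrite mul0r.
by rewrite inE/= in_itv/= mul1r; exact: bf_integrand_ge0.
Qed.

End bayes_factor_bounds.

(** * Asymptotics of the exponent *)

Section asymptotics.
Variables (R : realType) (D : nested_models R) (a r : R).
Hypothesis growth : growth_rates D a r.

Local Notation i n := (idim D n).
Local Notation p n := (pdim D n).

Let r1 : 1 < r. Proof. by case: growth. Qed.
Let r0 : 0 < r. Proof. exact: lt_trans r1. Qed.

Let harmonic0 : (n%:R^-1 : R) @[n --> \oo] --> 0.
Proof. by rewrite -cvg_shiftS; exact: cvg_harmonic. Qed.

Lemma cvg_pdim_ratio : ((p n)%:R / n%:R : R) @[n --> \oo] --> r^-1.
Proof.
have [_ _ _ h _] := growth.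
apply: cvg_trans (cvgV (lt0r_neq0 r0) h).
by apply: near_eq_cvg; apply: nearW => n /=; rewrite invf_div.
Qed.

Lemma cvg_idim_ratio : ((i n)%:R / n%:R : R) @[n --> \oo] --> 0.
Proof.
have [/andP[a0 a1] iO _ _ _] := growth.
have [C C0 hC] : exists2 C : R, 0 < C & \forall n \near \oo, (i n)%:R <= C * n%:R `^ a.
  move/eqO_exP : iO => [C C0 h]; exists C => //; near=> n.
  have : `|(i n)%:R : R| <= C * `|n%:R `^ a : R| by near: n.
  by rewrite !ger0_norm ?powR_ge0.
apply/cvgrPdist_le => e e0; near=> n.
have n0 : 0 < n%:R :> R by near: n; exact: nbhs_infty_gtr.
rewrite sub0r normrN ger0_norm ?divr_ge0// ler_pdivrMr//.
have ni : (i n)%:R <= C * n%:R `^ a by near: n.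
apply: (le_trans ni).
(* This threshold is the solution of [C * n ^ a = e * n]. *)
have nM : (C / e) `^ (1 - a)^-1 <= n%:R by near: n; exact: nbhs_infty_ger.
have Ce : 0 < C / e by rewrite divr_gt0.
have : C / e <= n%:R `^ (1 - a).
  have -> : C / e = ((C / e) `^ (1 - a)^-1) `^ (1 - a).
    by rewrite -powRrM mulVf ?powRr1 ?ltW// gt_eqF// subr_gt0.
  by apply: ge0_ler_powR => //; rewrite ?nnegrE ?powR_ge0 ?subr_ge0 ?ltW.
rewrite ler_pdivrMr// => h.
have -> : e * n%:R = n%:R `^ (1 - a) * e * n%:R `^ a.
  rewrite mulrAC -powRD; last by rewrite (gt_eqF n0) implybT.
  by rewrite subrK powRr1 ?ltW// mulrC.
by rewrite ler_wpM2r// powR_ge0.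
Unshelve. all: by end_near. Qed.

Let cvg_kap : (((p n)%:R + 1) / n%:R : R) @[n --> \oo] --> r^-1.
Proof.
rewrite -[r^-1]addr0; under eq_fun do rewrite mulrDl mul1r.
by apply: cvgD harmonic0; exact: cvg_pdim_ratio.
Qed.

Let nn1 : (n%:R / n%:R : R) @[n --> \oo] --> (1 : R).
Proof.
apply: cvg_near_cst; near=> n; rewrite divff// gt_eqF//.
by near: n; exact: nbhs_infty_gtr.
Unshelve. all: by end_near. Qed.

Let cvg_pi : (((p n)%:R - (i n)%:R) / n%:R : R) @[n --> \oo] --> r^-1.
Proof.
rewrite -[r^-1]subr0; under eq_fun do rewrite mulrBl.
by apply: cvgB; [exact: cvg_pdim_ratio|exact: cvg_idim_ratio].
Qed.

Lemma cvg_np : ((n%:R - (p n)%:R) / n%:R : R) @[n --> \oo] --> 1 - r^-1.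
Proof.
by under eq_fun do rewrite mulrBl; apply: cvgB => //; exact: cvg_pdim_ratio.
Qed.

Lemma cvg_ni : ((n%:R - (i n)%:R) / n%:R : R) @[n --> \oo] --> (1 : R).
Proof.
rewrite -[X in _ --> X]subr0.
by under eq_fun do rewrite mulrBl; apply: cvgB => //; exact: cvg_idim_ratio.
Qed.

Definition bf_rate b := (1 - r^-1) * ln (r + 1) - ln (r * b + 1) : R.

Lemma cvg_bf_exponent b : 0 < b ->
  bf_exponent n (p n) (i n) b 1 @[n --> \oo] --> bf_rate b.
Proof.
move=> b0; have rV : 0 < r^-1 by rewrite invr_gt0.
(* The termwise limit of the exponent. The terms in [ln r] cancel because the weights [r^-1] and
   [1 - r^-1] add up to 1. *)
have -> : bf_rate b = r^-1 * ln r^-1 + (1 - r^-1) * ln (1 + r^-1) - 1 * ln (b + r^-1).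
  have -> : 1 + r^-1 = (r + 1) / r by field; rewrite gt_eqF.
  have -> : b + r^-1 = (r * b + 1) / r by field; rewrite gt_eqF.
  rewrite !ln_div ?posrE ?addr_gt0 ?mulr_gt0// lnV ?posrE// /bf_rate; ring.
rewrite /bf_exponent; under eq_fun do rewrite !mulr1.
have cln (f : nat -> R) (x : R) : 0 < x -> f n @[n --> \oo] --> x ->
    ln (f n) @[n --> \oo] --> ln x.
  by move=> x0 fx; apply: continuous_cvg => //; exact: continuous_ln.
apply: cvgB; [apply: cvgD|]; apply: cvgM => //.
- exact: cln.
- exact: cvg_np.
- by apply: cln; [rewrite addr_gt0|apply: cvgD => //; exact: cvg_cst].
- exact: cvg_ni.
- by apply: cln; [rewrite addr_gt0|apply: cvgD => //; exact: cvg_cst].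
Qed.

(** After division by [n], the left side minus the right side tends to [r^-1 * (1 - r^-1 - 2 * c)],
    which is negative. *)
Lemma bf_exponent_le_cond c : 0 < c -> 1 - r^-1 < 2 * c ->
  \forall n \near \oo, (n%:R - (p n)%:R) * (c + ((p n)%:R + 1) / n%:R) <=
    (n%:R - (i n)%:R) * c * (1 + ((p n)%:R + 1) / n%:R).
Proof.
move=> c0 hc; have rV : 0 < r^-1 by rewrite invr_gt0.
pose f n : R := (n%:R - (p n)%:R) / n%:R * (c + ((p n)%:R + 1) / n%:R) -
  (n%:R - (i n)%:R) / n%:R * c * (1 + ((p n)%:R + 1) / n%:R).
have cf : f n @[n --> \oo] --> (1 - r^-1) * (c + r^-1) - 1 * c * (1 + r^-1).
  apply: cvgB; first apply: cvgM.
  - exact: cvg_np.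
  - by apply: cvgD => //; exact: cvg_cst.
  - apply: cvgM; last by apply: cvgD => //; exact: cvg_cst.
    by apply: cvgM; [exact: cvg_ni|exact: cvg_cst].
have lim_lt0 : (1 - r^-1) * (c + r^-1) - 1 * c * (1 + r^-1) < 0 by nra.
near=> n.
have n0 : 0 < n%:R :> R by near: n; exact: nbhs_infty_gtr.
have : f n < 0 by near: n; exact: cvgr_lt cf _ lim_lt0.
move=> fn0; rewrite -subr_le0.
apply: le_trans (_ : _ <= n%:R * f n) _; last by rewrite pmulr_rle0// ltW.
by rewrite le_eqVlt; apply/orP; left; apply/eqP; rewrite /f; field; rewrite gt_eqF.
Unshelve. all: by end_near. Qed.

End asymptotics.

(** * Convergence in probability *)

Lemma exists_near_left (R : realType) (Q : R -> Prop) (z x0 : R) : z < x0 ->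
  (\forall x \near x0^'-, Q x) -> exists2 x, z < x < x0 & Q x.
Proof.
move=> zx0 Qx; near x0^'- => x; exists x; last by near: x.
by apply/andP; split; near: x; [exact: nbhs_left_gt|exact: nbhs_left_lt].
Unshelve. all: by end_near. Qed.

Section sampling.
Variables (R : realType) (d : nat -> measure_display)
  (T : forall n, measurableType (d n)) (P : forall n, probability (T n) R)
  (y : forall n, T n -> 'cV[R]_n) (mean : forall n, 'cV[R]_n) (sigma : nat -> R).
Hypothesis normal_y : forall n, (2 < n)%N ->
  0 < sigma n /\ spherical_normal (P n) (@y n) (mean n) (sigma n).

Let measurable_y n k : (2 < n)%N -> measurable_fun [set: T n] (fun t => y t k 0).
Proof. by move=> /normal_y[_ []]. Qed.

Lemma measurable_residual_ss n k (X : 'M[R]_(n, k)) : (2 < n)%N ->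
  measurable_fun [set: T n] (fun t => residual_ss X (y t)).
Proof.
move=> n2; rewrite /residual_ss; under eq_fun do rewrite mxE.
apply: measurable_sum => j; apply: measurable_funM; last exact: measurable_y.
under eq_fun do rewrite mxE; apply: measurable_sum => k0.
by apply: measurable_funM => //; under eq_fun do rewrite mxE; exact: measurable_y.
Qed.

Let measurable_gt_norm n (f : T n -> R) (c e : R) : measurable_fun [set: T n] f ->
  measurable [set t | e < `|f t - c|].
Proof.
move=> mf; rewrite (_ : mkset _ = (fun t => `|f t - c|) @^-1` `]e, +oo[); last first.
  by apply/seteqP; split=> t; rewrite /= in_itv/= andbT.
rewrite -[X in measurable X]setTI; apply: measurableT_comp => //.
exact: measurable_funB.
Qed.

Let n_infty0 : (n%:R^-1 : R) @[n --> \oo] --> 0.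
Proof. by rewrite -cvg_shiftS; exact: cvg_harmonic. Qed.

Lemma residual_ss_cvg (k : nat -> nat) (X : forall n, 'M[R]_(n, k n)) (c l : R) :
  (forall n, (2 < n)%N -> \rank (X n) = k n) ->
  (n%:R - (k n)%:R) / n%:R @[n --> \oo] --> c ->
  ((mean n)^T *m (1%:M - hat_mx (X n)) *m mean n) 0 0 / sigma n ^+ 2 / n%:R
    @[n --> \oo] --> l ->
  forall eps : R, 0 < eps ->
  P n [set t | eps < `|residual_ss (X n) (y t) / sigma n ^+ 2 / n%:R - (c + l)|]
    @[n --> \oo] --> 0%E.
Proof.
move=> rX nk; pose v n := ((mean n)^T *m (1%:M - hat_mx (X n)) *m mean n) 0 0 / sigma n ^+ 2.
move=> vl eps eps0.
have e20 : 0 < eps / 2 by lra.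
(* The Chebyshev bound at deviation [eps / 2 * n], written as a convergent sequence times [1 / n].
   The other half of [eps] absorbs the distance of the normalised mean from its limit. *)
pose u n : R := (eps / 2) ^- 2 * (1028 * ((n%:R - (k n)%:R) / n%:R) + 8 * (v n / n%:R)) * n%:R^-1.
have u0 : (u n)%:E @[n --> \oo] --> 0%E.
  apply: cvg_EFin; first by apply: nearW.
  have -> : 0%R = (eps / 2) ^- 2 * (1028 * c + 8 * l) * 0 :> R by rewrite mulr0.
  apply: cvgM n_infty0; apply: cvgM; first exact: cvg_cst.
  by apply: cvgD; (apply: cvgM; first exact: cvg_cst).
apply: (squeeze_cvge _ (cvg_cst _) u0); near=> n.
have n2 : (2 < n)%N by near: n; exact: nbhs_infty_gt.
rewrite measure_ge0 /=.
have n0 : 0 < n%:R :> R by rewrite ltr0n (leq_ltn_trans _ n2).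
have close : `|((n%:R - (k n)%:R) / n%:R + v n / n%:R) - (c + l)| <= eps / 2.
  rewrite distrC; near: n.
  have /cvgrPdist_le : (n%:R - (k n)%:R) / n%:R + v n / n%:R @[n --> \oo] --> c + l.
    exact: cvgD.
  exact.
have [s0 ny] := normal_y n2.
have en0 : 0 < eps / 2 * n%:R by rewrite mulr_gt0.
have := quadratic_form_concentration s0 ny (residual_mx_tr (X n))
  (residual_mx_idem (rX _ n2)) en0.
rewrite mxtrace_residual ?rX// -/(v n).
have -> : (eps / 2 * n%:R) ^- 2 * (1028 * (n%:R - (k n)%:R) + 8 * v n) = u n.
  by rewrite /u; field; rewrite !gt_eqF.
apply: le_trans; apply: le_measure; rewrite ?inE.
- apply: measurable_gt_norm; apply: measurable_funM => //; apply: measurable_funM => //.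
  exact: measurable_residual_ss.
- apply: measurable_gt_norm; apply: measurable_funM => //.
  exact: measurable_residual_ss.
- move=> t /= h; rewrite -/(residual_ss _ _).
  set q := residual_ss _ _ / _ in h *.
  have -> : q - (n%:R - (k n)%:R + v n) =
      (q / n%:R - ((n%:R - (k n)%:R) / n%:R + v n / n%:R)) * n%:R.
    by field; rewrite gt_eqF.
  rewrite normrM (gtr0_norm n0) ltr_pM2r//.
  have := ler_distD ((n%:R - (k n)%:R) / n%:R + v n / n%:R) (q / n%:R) (c + l).
  by lra.
Unshelve. all: by end_near. Qed.

Lemma quotient_near (u v b1 b2 : R) : 0 < b1 -> 0 < v -> b1 < u / v < b2 ->
  exists2 eta : R, 0 < eta & forall x z : R, `|x - u| <= eta -> `|z - v| <= eta ->
    b1 <= x / z <= b2.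
Proof.
move=> b10 v0 /andP[]; rewrite ltr_pdivlMr// ltr_pdivrMr// => h1 h2.
have b20 : 0 < b2.
  by rewrite -(@pmulr_lgt0 _ v)// (lt_trans _ h2)// (lt_trans _ h1)// mulr_gt0.
(* These solve [u - e1 = b1 * (v + e1)] and [u + e2 = b2 * (v - e2)], the worst cases of the two
   bounds; the further constraint [v / 2] keeps [z] positive. *)
pose e1 := (u - b1 * v) / (1 + b1); pose e2 := (b2 * v - u) / (1 + b2).
have [b1p b2p] : 0 < 1 + b1 /\ 0 < 1 + b2 by split; lra.
pose eta := Num.min (v / 2) (Num.min e1 e2).
have eta0 : 0 < eta.
  by rewrite /eta !lt_min !divr_gt0// subr_gt0.
exists eta => // x z.
have hv : eta <= v / 2 by rewrite /eta ge_min lexx.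
have he1 : eta <= e1 by rewrite /eta !ge_min lexx orbT.
have he2 : eta <= e2 by rewrite /eta !ge_min lexx !orbT.
rewrite !ler_norml => /andP[x1 x2] /andP[z1 z2].
have z0 : 0 < z by lra.
move: he1 he2; rewrite /e1 /e2 !ler_pdivlMr// => he1 he2.
rewrite ler_pdivrMr//; apply/andP; split; nra.
Qed.

Variables (D : nested_models R) (a r : R).
Hypothesis growth : growth_rates D a r.

Hypothesis mean_full : forall n, (2 < n)%N ->
  (1%:M - hat_mx (full_design D n)) *m mean n = 0.
Variable l : R.
Hypothesis cvg_dist : ((mean n)^T *m (1%:M - hat_mx (reduced_design D n)) *m mean n) 0 0 /
  sigma n ^+ 2 / n%:R @[n --> \oo] --> l.

Let r1 : 1 < r. Proof. by case: growth. Qed.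
Let r0 : 0 < r. Proof. exact: lt_trans r1. Qed.

Let rank_reduced n : (2 < n)%N -> \rank (reduced_design D n) = idim D n.
Proof.
move=> n2; apply: mxrank_colsub; first exact: columns_inj.
exact: full_column_rank.
Qed.

Lemma dist_ge0 : 0 <= l.
Proof.
rewrite -(cvg_lim _ cvg_dist)//; apply: limr_ge; first exact: cvgP cvg_dist.
near=> n; have n2 : (2 < n)%N by near: n; exact: nbhs_infty_gt.
rewrite !divr_ge0// ?sqr_ge0//.
exact: residual_form_ge0 (rank_reduced n2) _.
Unshelve. all: by end_near. Qed.

Lemma measurable_B_ip n : (2 < n)%N -> measurable_fun [set: T n] (fun t => B_ip D (y t)).
Proof.
move=> n2; rewrite /B_ip; apply: measurable_funM; first exact: measurable_residual_ss.
under eq_fun do rewrite -powR_inv1 ?(residual_form_ge0 (rank_reduced n2))//.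
apply: (@measurableT_comp _ _ _ _ _ _ (fun x => x `^ _)); first exact: measurable_powR.
exact: measurable_residual_ss.
Qed.

Let measurable_B_set n (b1 b2 : R) : (2 < n)%N ->
  measurable [set t | ~~ (b1 <= B_ip D (@y n t) <= b2)].
Proof.
move=> n2; rewrite (_ : mkset _ = ~` ((fun t => B_ip D (@y n t)) @^-1` `[b1, b2])).
  apply: measurableC; rewrite -[X in measurable X]setTI; exact: measurable_B_ip.
by apply/seteqP; split=> t; rewrite /= in_itv/= => /negP.
Qed.

Let b := (1 - r^-1) / (1 + l).

Lemma B_ip_cvg b1 b2 : 0 < b1 -> b1 < b < b2 ->
  P n [set t | ~~ (b1 <= B_ip D (y t) <= b2)] @[n --> \oo] --> 0%E.
Proof.
move=> b10 b12; have l0 := dist_ge0.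
have u0 : 0 < 1 - r^-1 by rewrite subr_gt0 invf_lt1.
have v0 : 0 < 1 + l by lra.
have [eta eta0 H] := quotient_near b10 v0 b12.
have cvgU : P n [set t | eta < `|residual_ss (full_design D n) (y t) / sigma n ^+ 2 / n%:R
    - (1 - r^-1 + 0)|] @[n --> \oo] --> 0%E.
  apply: residual_ss_cvg => //; [exact: full_column_rank|exact: cvg_np growth|].
  apply: cvg_near_cst; near=> n.
  have n2 : (2 < n)%N by near: n; exact: nbhs_infty_gt.
  by rewrite -mulmxA mean_full// mulmx0 mxE !mul0r.
have cvgV := residual_ss_cvg rank_reduced (cvg_ni growth) cvg_dist eta0.
have def0 : ((0 : \bar R) +? 0)%E by [].
have cvgUV := cvgeD def0 cvgU cvgV; rewrite adde0 in cvgUV.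
apply: (squeeze_cvge _ (cvg_cst _) (cvgUV eventually_filter)); near=> n.
have n2 : (2 < n)%N by near: n; exact: nbhs_infty_gt.
rewrite measure_ge0 /=.
have [s0 _] := normal_y n2.
set SU := [set t | _ < `|_ - (1 - r^-1 + 0)|]; set SV := [set t | _ < _].
have mU : measurable SU.
  apply: measurable_gt_norm; apply: measurable_funM => //; apply: measurable_funM => //.
  exact: measurable_residual_ss.
have mV : measurable SV.
  apply: measurable_gt_norm; apply: measurable_funM => //; apply: measurable_funM => //.
  exact: measurable_residual_ss.
apply: (le_trans _ (measureU2 _ mU mV)).
apply: le_measure; rewrite ?inE.
- exact: measurable_B_set.
- exact: measurableU.
- move=> t /=; apply: contraNP => /not_orP[]; rewrite /SU /SV /= addr0.
  move=> /negP; rewrite -leNgt => hU /negP; rewrite -leNgt => hV.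
  have := H _ _ hU hV; rewrite /B_ip.
  have n0 : 0 < n%:R :> R by rewrite ltr0n (leq_ltn_trans _ n2).
  set q1 := residual_ss _ _; set q2 := residual_ss _ _.
  suff -> : q1 / sigma n ^+ 2 / n%:R / (q2 / sigma n ^+ 2 / n%:R) = q1 / q2 by [].
  have c0 : (sigma n ^+ 2)^-1 * n%:R^-1 != 0.
    by rewrite mulf_neq0// invr_neq0// gt_eqF// exprn_gt0.
  by rewrite -(mulrA q1) -(mulrA q2) (invfM q2) mulrACA divff// mulr1.
Unshelve. all: by end_near. Qed.

Lemma bayes_factor_bf n (z : 'cV[R]_n) :
  bayes_factor D z = bf_of_ratio n (pdim D n) (idim D n) (B_ip D z).
Proof. by []. Qed.

Lemma measurable_bayes_factor n : (2 < n)%N ->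
  measurable_fun [set: T n] (fun t => bayes_factor D (y t)).
Proof.
move=> n2; have /and3P[_ ip pn] := dims_ordered D n2.
apply: (@measurableT_comp _ _ _ _ _ _ (bf_of_ratio n (pdim D n) (idim D n))).
  exact: measurable_bf_of_ratio.
exact: measurable_B_ip.
Qed.

Let W := (r + 1) `^ ((r - 1) / r).

Let W_gt1 : 1 < W. Proof. exact: pow_gt1. Qed.

Let b_gt0 : 0 < b.
Proof. by rewrite divr_gt0// ?subr_gt0 ?invf_lt1//; have := dist_ge0; lra. Qed.

Let ln_W : ln W = (1 - r^-1) * ln (r + 1).
Proof. by rewrite ln_powR; congr (_ * _); field; rewrite gt_eqF. Qed.

Let bf_rate_lt0 c : 0 < c -> (bf_rate r c < 0) = ((W - 1) / r < c).
Proof.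
move=> c0; rewrite /bf_rate -ln_W subr_lt0 ltr_ln ?posrE ?addr_gt0 ?mulr_gt0//.
  by rewrite ltr_pdivrMr// ltrBlDr mulrC.
exact: lt_trans W_gt1.
Qed.

Let bf_rate_gt0 c : 0 < c -> (0 < bf_rate r c) = (c < (W - 1) / r).
Proof.
move=> c0; rewrite /bf_rate -ln_W subr_gt0 ltr_ln ?posrE ?addr_gt0 ?mulr_gt0//.
  by rewrite ltr_pdivlMr// ltrBrDr mulrC.
exact: lt_trans W_gt1.
Qed.

(* [delta r] is the value of [l] for which [b] equals [(W - 1) / r]. *)
Let delta_lt : (l < delta r) = ((W - 1) / r < b).
Proof.
have l0 := dist_ge0; have W1 := W_gt1.
rewrite /delta -/W ltrBrDr ltr_pdivlMr ?subr_gt0//.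
have l1 : 0 < 1 + l by lra.
rewrite /b [RHS]ltr_pdivlMr// [in RHS]mulrAC [RHS]ltr_pdivrMr//.
have -> : (1 - r^-1) * r = r - 1 by field; rewrite gt_eqF.
by rewrite mulrC [l + 1]addrC.
Qed.

Let delta_gt : (delta r < l) = (b < (W - 1) / r).
Proof.
have l0 := dist_ge0; have W1 := W_gt1.
rewrite /delta -/W ltrBlDr ltr_pdivrMr ?subr_gt0//.
have l1 : 0 < 1 + l by lra.
rewrite /b [RHS]ltr_pdivrMr// [in RHS]mulrAC [RHS]ltr_pdivlMr//.
have -> : (1 - r^-1) * r = r - 1 by field; rewrite gt_eqF.
by rewrite mulrC [l + 1]addrC.
Qed.

Lemma bayes_factor_cvg0 : l < delta r ->
  cvg_in_probability P (fun n t => bayes_factor D (y t)) 0.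
Proof.
rewrite delta_lt => Wb; split.
  by near=> n; apply: measurable_bayes_factor; near: n; exact: nbhs_infty_gt.
move=> eps eps0; pose b1 := (b + (W - 1) / r) / 2.
have Wr0 : 0 < (W - 1) / r by rewrite divr_gt0// subr_gt0.
have b1W : (W - 1) / r < b1 by rewrite /b1; lra.
have b10 : 0 < b1 by exact: lt_trans b1W.
have b12 : b1 < b < b + 1 by rewrite /b1; apply/andP; split; lra.
have rate0 : bf_rate r b1 < 0 by rewrite bf_rate_lt0.
have hb1 : 1 - r^-1 < 2 * b1.
  have := pow_ge r1; rewrite -/W => W2.
  suff : 1 - r^-1 <= 2 * ((W - 1) / r) by lra.
  have -> : 1 - r^-1 = (r - 1) / r by field; rewrite gt_eqF.
  by rewrite mulrA ler_pM2r ?invr_gt0//; lra.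
apply: (squeeze_cvge _ (cvg_cst _) (B_ip_cvg b10 b12)); near=> n.
have n2 : (2 < n)%N by near: n; exact: nbhs_infty_gt.
have n0 : 0 < n%:R :> R by rewrite ltr0n (leq_ltn_trans _ n2).
rewrite measure_ge0 /=; apply: le_measure; rewrite ?inE.
- by apply: measurable_gt_norm; exact: measurable_bayes_factor.
- exact: measurable_B_set.
have /and3P[_ ip pn] := dims_ordered D n2.
move=> t /=; apply: contraTN => /andP[B1 _].
have B0 := lt_le_trans b10 B1.
rewrite subr0 -leNgt bayes_factor_bf ger0_norm ?bf_of_ratio_ge0//.
have hk : (n%:R - (pdim D n)%:R) * (b1 + ((pdim D n)%:R + 1) / n%:R) <=
   (n%:R - (idim D n)%:R) * b1 * (1 + ((pdim D n)%:R + 1) / n%:R).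
  by near: n; exact: (bf_exponent_le_cond growth b10 hb1).
have hk' : (n%:R - (pdim D n)%:R) * (B_ip D (y t) + ((pdim D n)%:R + 1) / n%:R) <=
   (n%:R - (idim D n)%:R) * B_ip D (y t) * (1 + ((pdim D n)%:R + 1) / n%:R).
  move: hk; set k := _ / n%:R; set B := B_ip _ _ in B1 *.
  have k0 : 0 <= k by rewrite divr_ge0// addr_ge0.
  have ni : 0 <= n%:R - (idim D n)%:R :> R by rewrite subr_ge0 ler_nat ltnW// (ltn_trans ip).
  have pi' : (idim D n)%:R <= (pdim D n)%:R :> R by rewrite ler_nat ltnW.
  move=> hk.
  have : 0 <= (B - b1) * ((n%:R - (idim D n)%:R) * k + ((pdim D n)%:R - (idim D n)%:R)).
    apply: mulr_ge0; first by rewrite subr_ge0.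
    by apply: addr_ge0; [exact: mulr_ge0|rewrite subr_ge0].
  move=> h; rewrite -subr_ge0 in hk; rewrite -subr_ge0.
  apply: le_trans (addr_ge0 hk h) _.
  by rewrite le_eqVlt; apply/orP; left; apply/eqP; ring.
apply: (le_trans (bf_of_ratio_le ip pn B0 hk')).
have h : bf_exponent n (pdim D n) (idim D n) (B_ip D (y t)) 1 <= bf_rate r b1 / 2.
  apply: (le_trans (bf_exponent_le_ratio ip pn b10 B1 ltr01)); apply: ltW.
  near: n; have := cvgr_lt _ (cvg_bf_exponent growth b10); apply.
  by lra.
rewrite -[leRHS]lnK ?posrE// ler_expR.
rewrite (le_trans (ler_wpM2l _ h)) ?divr_ge0//.
have -> : n%:R / 2 * (bf_rate r b1 / 2) = n%:R * (bf_rate r b1 / 4) by field.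
rewrite -ler_ndivrMr; last by lra.
near: n; exact: nbhs_infty_ger.
Unshelve. all: by end_near. Qed.

Lemma bayes_factor_cvgy : delta r < l ->
  cvg_in_probability_pinfty P (fun n t => bayes_factor D (y t)).
Proof.
rewrite delta_gt => Wb; split.
  by near=> n; apply: measurable_bayes_factor; near: n; exact: nbhs_infty_gt.
move=> M; pose b2 := (b + (W - 1) / r) / 2.
have b0 := b_gt0.
have b2W : b2 < (W - 1) / r by rewrite /b2; lra.
have bb2 : b < b2 by rewrite /b2; lra.
have b20 : 0 < b2 by exact: lt_trans bb2.
have b120 : 0 < b / 2 by lra.
have b12 : b / 2 < b < b2 by apply/andP; split; lra.
have rate0 : 0 < bf_rate r b2 by rewrite bf_rate_gt0.
have pi0 := pi_gt0 R.
have [phi0 phi0_itv phi0_sin] : exists2 phi0 : R, 0 < phi0 < pi / 2 &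
    - (bf_rate r b2 / 4) <= ln (sin phi0 ^+ 2).
  have sin1 : ln (sin x ^+ 2) @[x --> (pi / 2)^'-] --> (0 : R).
    rewrite -[X in _ --> X]ln1; apply: continuous_cvg.
      exact: continuous_ln.
    have e1 : sin (pi / 2) ^+ 2 = 1 :> R by rewrite sin_pihalf expr1n.
    rewrite -[X in _ --> X]e1; apply: cvg_at_left_filter.
    exact: (cvgM (@continuous_sin R _) (@continuous_sin R _)).
  have sin2 : \forall x \near (pi / 2)^'-, - (bf_rate r b2 / 4) <= ln (sin x ^+ 2).
    by apply: cvgr_ge sin1 _ _; lra.
  have pi2 : 0 < pi / 2 :> R by lra.
  by have [x x_itv xP] := exists_near_left pi2 sin2; exists x.
have [phi00 phi01] := andP phi0_itv.
pose c := 1 - 2 / pi * phi0.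
have c0 : 0 < c.
  by rewrite /c subr_gt0 mulrAC ltr_pdivrMr//; lra.
have PB1 : (1 - P n [set t | ~~ (b / 2 <= B_ip D (y t) <= b2)%R])%E @[n --> \oo] --> 1%E.
  rewrite -[X in _ --> X]sube0; apply: cvgeB => //; first exact: cvg_cst.
  exact: B_ip_cvg.
apply: (squeeze_cvge _ PB1 (cvg_cst _)); near=> n.
have n2 : (2 < n)%N by near: n; exact: nbhs_infty_gt.
have n0 : 0 < n%:R :> R by rewrite ltr0n (leq_ltn_trans _ n2).
have mM : measurable [set t | M < bayes_factor D (@y n t)].
  rewrite (_ : mkset _ = (fun t => bayes_factor D (@y n t)) @^-1` `]M, +oo[); last first.
    by apply/seteqP; split=> t; rewrite /= in_itv/= andbT.
  by rewrite -[X in measurable X]setTI; exact: measurable_bayes_factor.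
rewrite probability_le1// andbT -probability_setC; last exact: measurable_B_set.
apply: le_measure; rewrite ?inE//.
  by apply: measurableC; exact: measurable_B_set.
have /and3P[_ ip pn] := dims_ordered D n2.
move=> t /= /negP; rewrite negbK => /andP[B1 B2].
have B0 := lt_le_trans b120 B1.
rewrite bayes_factor_bf; have BB : 0 < B_ip D (y t) <= b2 by rewrite B0.
apply: lt_le_trans (bf_of_ratio_ge ip pn BB phi0_itv); rewrite -/c.
have s01 : 0 < sin phi0 ^+ 2 <= 1.
  have s0 : 0 < sin phi0 by rewrite sin_gt0_pi// phi00/=; lra.
  by rewrite exprn_gt0//= expr_le1// ?sin_le1// ltW.
have h : bf_rate r b2 / 4 <= bf_lower_exponent n (pdim D n) (idim D n) b2 (sin phi0 ^+ 2).
  apply: (le_trans _ (bf_lower_exponent_ge _ pn b2 s01)).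
  have : bf_rate r b2 / 2 <= bf_exponent n (pdim D n) (idim D n) b2 1.
    near: n; have := cvgr_ge _ (cvg_bf_exponent growth b20); apply.
    by lra.
  by lra.
apply: (@lt_le_trans _ _ (c * expR (n%:R * (bf_rate r b2 / 8)))); last first.
  rewrite ler_pM2l// ler_expR.
  have -> : n%:R * (bf_rate r b2 / 8) = n%:R / 2 * (bf_rate r b2 / 4) by field.
  by rewrite ler_wpM2l// divr_ge0.
rewrite -ltr_pdivrMl//; apply: lt_le_trans (expR_ge1Dx _).
rewrite ltr_pwDl//.
rewrite -ler_pdivrMr; last by lra.
near: n; exact: nbhs_infty_ger.
Unshelve. all: by end_near. Qed.

End sampling.

Theorem theorem2 (R : realType) :
  (forall (D : nested_models R) (a r : R), growth_rates D a r ->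
    forall (d : nat -> measure_display) (T : forall n, measurableType (d n))
      (P : forall n, probability (T n) R) (y : forall n, T n -> 'cV[R]_n)
      (alpha : forall n, 'cV[R]_(idim D n)) (sigma : nat -> R),
    sampling_from_reduced P y alpha sigma ->
    cvg_in_probability P (fun n t => bayes_factor D (y n t)) 0)
  /\
  exists delta : R -> R,
    (forall (D : nested_models R) (a r : R), growth_rates D a r ->
      forall (d : nat -> measure_display) (T : forall n, measurableType (d n))
        (P : forall n, probability (T n) R) (y : forall n, T n -> 'cV[R]_n)
        (beta : forall n, 'cV[R]_(pdim D n)) (sigma : nat -> R) (l : R),
      sampling_from_full P y beta sigma ->
      delta_pi (beta n) (sigma n) @[n --> \oo] --> l ->
      (delta r < l ->
        cvg_in_probability_pinfty P (fun n t => bayes_factor D (y n t))) /\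
      (l < delta r ->
        cvg_in_probability P (fun n t => bayes_factor D (y n t)) 0)) /\
    [/\ forall r : R, 1 < r ->
          delta r = (r - 1) / ((r + 1) `^ ((r - 1) / r) - 1) - 1,
        {in `]1, +oo[ &, {homo delta : r s / r < s >-> s < r}},
        convex_function (`]1, +oo[ : set R^o) delta &
        delta r @[r --> +oo] --> 0].
Proof.
have full0 (D : nested_models R) n : (2 < n)%N ->
    (1%:M - hat_mx (full_design D n)) *m full_design D n = 0.
  by move=> n2; apply: residual_mx_design; exact: full_column_rank.
split.
  move=> D a r growth d T P y alpha sigma sampling.
  have r1 : 1 < r by case: growth.
  have reducedE n : reduced_design D n = full_design D n *m colsub (@columns R D n) 1%:M.
    by rewrite mulmx_colsub mulmx1.
  apply: (bayes_factor_cvg0 sampling growth _ _ (delta_gt0 r1)).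
  - by move=> n n2; rewrite reducedE -mulmxA mulmxA full0// mul0mx.
  - apply: cvg_near_cst; near=> n.
    have n2 : (2 < n)%N by near: n; exact: nbhs_infty_gt.
    rewrite -mulmxA [(1%:M - _) *m _]mulmxA residual_mx_design.
      by rewrite mul0mx mulmx0 mxE !mul0r.
    apply: mxrank_colsub; first exact: columns_inj.
    exact: full_column_rank.
exists (@delta R); split; last first.
  split.
  - by [].
  - by move=> r s; rewrite !in_itv/= !andbT => r1 _; exact: delta_decreasing.
  - move=> t r s; rewrite !inE/= !in_itv/= !andbT => r1 s1.
    have t1 : 0 <= 1 - t%:num :> R by rewrite subr_ge0.
    by apply: delta_convex => //; exact: subrKC.
  - exact: delta_cvgy.
move=> D a r growth d T P y beta sigma l sampling cvg_delta.
have mean_full n : (2 < n)%N ->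
    (1%:M - hat_mx (full_design D n)) *m (full_design D n *m beta n) = 0.
  by move=> n2; rewrite mulmxA full0// mul0mx.
have cvg_dist : (((full_design D n *m beta n)^T *m
    (1%:M - hat_mx (reduced_design D n)) *m (full_design D n *m beta n)) 0 0 /
    sigma n ^+ 2 / n%:R) @[n --> \oo] --> l.
  apply: cvg_trans cvg_delta; apply: near_eq_cvg; apply: nearW => n.
  rewrite /delta_pi -scalemxAr -scalemxAl mxE trmx_mul !mulmxA.
  by rewrite mulrA mulrC mulrA.
split.
  exact: (bayes_factor_cvgy sampling growth mean_full cvg_dist).
exact: (bayes_factor_cvg0 sampling growth mean_full cvg_dist).
Unshelve. all: by end_near. Qed.
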